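(* Let $\Gamma,\tilde\Gamma$ be groups and $\alpha\in\mathrm{Aut}(\Gamma)$, $\tilde\alpha\in\mathrm{Aut}(\tilde\Gamma)$. Let $G=\bigoplus_{\mathbf{Q}_2}\Gamma\rtimes_\alpha V$ and $\tilde G=\bigoplus_{\mathbf{Q}_2}\tilde\Gamma\rtimes_{\tilde\alpha} V$ be the associated fraction groups. Then $G$ and $\tilde G$ are isomorphic if and only if there exist a group isomorphism $\beta:\Gamma\to\tilde\Gamma$ and $h\in\tilde\Gamma$ such that $\tilde\alpha=\mathrm{ad}(h)\circ\beta\circ\alpha\circ\beta^{-1}$, where $\mathrm{ad}(h)(g)=hgh^{-1}$.
   Context: Cantor space is $\mathfrak C=\{0,1\}^{\mathbf N}$ with the product topology. For a finite word $m$ in $\{0,1\}$ let $C_m=\{m\cdot x: x\in\{0,1\}^{\mathbf N}\}$ (concatenation). Thompson's group $V$ is the group of homeomorphisms $v$ of $\mathfrak C$ for which there exist two partitions $\mathfrak C=\bigsqcup_{k=1}^n C_{m_k}=\bigsqcup_{k=1}^n C_{m'_k}$ with $v(m_k\cdot x)=m'_k\cdot x$ for all $k$ and all $x$. For such $v$ and $x\in C_{m_k}$, the slope is $v'(x)=2^{|m_k|-|m'_k|}$ (independent of choices); it satisfies the chain rule $(vw)'(x)=v'(wx)w'(x)$. $\mathbf{Q}_2\subset\mathfrak C$ is the set of sequences that are eventually $0$ (identified with the dyadic rationals of $[0,1)$ via $x\mapsto\sum_{n\ge1}x_n2^{-n}$); it is $V$-invariant. For a group $\Gamma$ and $\alpha\in\mathrm{Aut}(\Gamma)$,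 $\bigoplus_{\mathbf{Q}_2}\Gamma$ is the group of finitely supported maps $\mathbf{Q}_2\to\Gamma$, and $V$ acts on it by $(v\cdot a)(x)=\alpha^{\log_2 v'(v^{-1}x)}(a(v^{-1}x))$; the semidirect product $\bigoplus_{\mathbf{Q}_2}\Gamma\rtimes_\alpha V$ is (isomorphic to) the fraction group given by Jones' technology from the covariant monoidal functor from binary forests to groups sending the one-caret tree to the morphism $\Gamma\to\Gamma\oplus\Gamma$, $g\mapsto(\alpha(g),e)$. *)

(* Defs.v *)
From Stdlib Require Import List ZArith Arith ClassicalEpsilon.
Import ListNotations.
Set Implicit Arguments.

Record Group := {
  gcar :> Type;
  gmul : gcar -> gcar -> gcar;
  gone : gcar;
  ginv : gcar -> gcar;
  gmulA : forall x y z, gmul x (gmul y z) = gmul (gmul x y) z;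
  gmul1l : forall x, gmul gone x = x;
  gmulVl : forall x, gmul (ginv x) x = gone
}.
Arguments gmul {g}.
Arguments gone {g}.
Arguments ginv {g}.

Definition group_iso {G H : Group} (f : G -> H) : Prop :=
  (forall x y, f (gmul x y) = gmul (f x) (f y)) /\
  (forall x y, f x = f y -> x = y) /\
  (forall y, exists x, f x = y).

Record Aut (G : Group) := {
  aut_fun :> G -> G;
  aut_inv : G -> G;
  aut_hom : forall x y, aut_fun (gmul x y) = gmul (aut_fun x) (aut_fun y);
  aut_invK : forall x, aut_inv (aut_fun x) = x;
  aut_funK : forall x, aut_fun (aut_inv x) = x
}.

Definition autpow {G : Group} (a : Aut G) (z : Z) (g : G) : G :=
  match z with
  | Z0 => g
  | Zpos p => Nat.iter (Pos.to_nat p) (aut_fun a) g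
  | Zneg p => Nat.iter (Pos.to_nat p) (aut_inv a) g
  end.

Definition cantor := nat -> bool.
Definition word := list bool.

Definition in_cyl (m : word) (x : cantor) : Prop :=
  forall i, i < length m -> x i = nth i m false.

Definition wcat (m : word) (x : cantor) : cantor :=
  fun n => if n <? length m then nth n m false else x (n - length m).

Definition is_partition (ms : list word) : Prop :=
  forall x, exists! k, k < length ms /\ in_cyl (nth k ms []) x.

Definition isV (v : cantor -> cantor) : Prop :=
  exists ms ms' : list word,
    length ms = length ms' /\ is_partition ms /\ is_partition ms' /\
    forall k x, k < length ms -> v (wcat (nth k ms []) x) = wcat (nth k ms' []) x.

(** log_2 of the slope v'(x) = 2^(|m|-|m'|) (well defined for v in V) *)
Definition log2_slope (v : cantor -> cantor) (x : cantor) : Z :=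
  epsilon (inhabits 0%Z) (fun z => exists m m' : word,
    in_cyl m x /\ (forall y, v (wcat m y) = wcat m' y) /\
    z = (Z.of_nat (length m) - Z.of_nat (length m'))%Z).

Definition Vinv (v : cantor -> cantor) (x : cantor) : cantor :=
  epsilon (inhabits x) (fun y => v y = x).

Definition in_Q2 (x : cantor) : Prop := exists N, forall n, N <= n -> x n = false.

(** Elements are pairs (a, v): a a finitely supported map Q_2 -> Gamma
    (extended by the identity outside Q_2), v in V. *)
Definition raw (G : Group) := ((cantor -> G) * (cantor -> cantor))%type.

Definition fin_supp_Q2 {G : Group} (a : cantor -> G) : Prop :=
  exists l : list cantor, forall x, a x <> gone -> in_Q2 x /\ In x l.

Definition inSD {G : Group} (g : raw G) : Prop :=
  @fin_supp_Q2 G (fst g) /\ isV (snd g).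

Definition vact {G : Group} (al : Aut G) (v : cantor -> cantor) (a : cantor -> G)
  : cantor -> G :=
  fun x => autpow al (log2_slope v (Vinv v x)) (a (Vinv v x)).

Definition sdmul {G : Group} (al : Aut G) (g1 g2 : raw G) : raw G :=
  (fun x => gmul (fst g1 x) (vact al (snd g1) (fst g2) x),
   fun x => snd g1 (snd g2 x)).

Definition sd_isomorphic {G H : Group} (al : Aut G) (be : Aut H) : Prop :=
  exists phi : raw G -> raw H,
    (forall g, inSD g -> inSD (phi g)) /\
    (forall g1 g2, inSD g1 -> inSD g2 -> phi g1 = phi g2 -> g1 = g2) /\
    (forall h, inSD h -> exists g, inSD g /\ phi g = h) /\
    (forall g1 g2, inSD g1 -> inSD g2 ->
        phi (sdmul al g1 g2) = sdmul be (phi g1) (phi g2)).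

(* Main.v *)
Require Import Defs.
From Stdlib Require Import List ZArith Arith ClassicalEpsilon Classical
  FunctionalExtensionality FinFun Lia.
Import ListNotations.

(** Write [K] for the direct sum, so that [G = K.V].

    From left to right, let [theta : G -> G~] be an isomorphism.

    (1) [theta K = K~].  The image [N] of [theta K] in V is normal, and any finite
    subset of [N] commutes with a V-conjugate of any given element of [N], since this
    holds in [K] by disjointness of supports.  If [N] contained [n <> 1], moving a cone
    [C] off itself, then it would contain the commutators [[f, n]] for [f] supported on
    [C], which act as [f] on [C].  Conjugates of contractions obtained in this way leave
    no proper clopen set invariant, whereas the support of a conjugate of
    [[involution, n]] is clopen: a contradiction.

    (2) The induced automorphism [psi] of V maps point stabilisers in Q_2 to point
    stabilisers.  For [x] in Q_2, the support [F] of [theta a], with [a] supported at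
    [x], is preserved by [psi T_x], where [T_x] consists of the elements of V trivial
    near [x].  Subgroups containing [T_x] are V or fix [x], so [psi (Stab x)] contains
    all elements trivial near [F]; hence there is a nonempty finite [F0] such that
    [T_F0 <= psi (Stab x) <= Stab F0].  As V is doubly transitive on Q_2, there are
    only two double cosets of [Stab x], which forces [F0] to be a singleton [{y}].

    (3) The fixed points in Q_2 of elements of V determine which germs at [x] are
    trivial and which are attracting, so [psi] preserves slopes at [x].  Moreover
    [theta] maps the copy of Gamma at [x] onto the copy of Gamma~ at [y]; this is
    [beta].  Conjugating by [theta v], with [v] of slope 2 at [x], gives [h].

    From right to left, conjugation by [h] is absorbed by a 1-cocycle built on the
    slope.  It takes finitely supported values because [log2 v'(x)] equals
    [len x - len (v x)], with [len] the length of a finite binary expansion, for all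
    but finitely many [x] in Q_2. *)

(** * Integer iteration, group identities, powers of an automorphism *)

Definition ziter {T : Type} (f f' : T -> T) (z : Z) (x : T) : T :=
  match z with
  | Z0 => x
  | Zpos p => Nat.iter (Pos.to_nat p) f x
  | Zneg p => Nat.iter (Pos.to_nat p) f' x
  end.

(** Serves both the powers of an automorphism and [cocyc], whose step need not be a homomorphism. *)
Lemma ziter_succ {T : Type} (f f' : T -> T) z x :
  (forall y, f (f' y) = y) -> ziter f f' (Z.succ z) x = f (ziter f f' z x).
Proof.
  intros K. destruct z as [|p|p]; simpl; auto.
  - replace (p + 1)%positive with (Pos.succ p) by lia.
    now rewrite Pos2Nat.inj_succ.
  - destruct (Pos.eq_dec p 1) as [->|n]; simpl.
    + now rewrite K.
    + destruct (Pos.succ_pred p n).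
      set (q := Pos.pred p).
      replace (Z.pos_sub 1 (Pos.succ q)) with (Z.neg q)
        by (rewrite Z.pos_sub_lt; lia || (f_equal; lia)).
      rewrite Pos2Nat.inj_succ. simpl. now rewrite K.
Qed.

Section GroupFacts.
Variable G : Group.
Implicit Types x y : G.

Lemma gmulVr x : gmul x (ginv x) = gone.
Proof.
  rewrite <- (gmul1l G (gmul x (ginv x))).
  rewrite <- (gmulVl G (ginv x)) at 1.
  rewrite <- gmulA, (gmulA G (ginv x) x), gmulVl, gmul1l.
  apply gmulVl.
Qed.

Lemma gmul1r x : gmul x gone = x.
Proof. now rewrite <- (gmulVl G x), gmulA, gmulVr, gmul1l. Qed.

Lemma gmul_injl x y (z : G) : gmul x y = gmul x z -> y = z.
Proof.
  intros E. rewrite <- (gmul1l G y), <- (gmul1l G z), <- (gmulVl G x).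
  now rewrite <- !gmulA, E.
Qed.

Lemma gmul_injr x y (z : G) : gmul y x = gmul z x -> y = z.
Proof.
  intros E. rewrite <- (gmul1r y), <- (gmul1r z), <- (gmulVr x).
  now rewrite !gmulA, E.
Qed.

Lemma gmulKV x y : gmul (gmul x (ginv y)) y = x.
Proof. now rewrite <- gmulA, gmulVl, gmul1r. Qed.

Lemma gmulKl x y : gmul (ginv x) (gmul x y) = y.
Proof. now rewrite gmulA, gmulVl, gmul1l. Qed.

Lemma gmulKVl x y : gmul x (gmul (ginv x) y) = y.
Proof. now rewrite gmulA, gmulVr, gmul1l. Qed.

Lemma ginv_unique x y : gmul x y = gone -> y = ginv x.
Proof. intros E. apply (gmul_injl x). now rewrite E, gmulVr. Qed.

Lemma ginv1 : ginv (@gone G) = gone.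
Proof. symmetry. apply ginv_unique, gmul1l. Qed.

Lemma ginvK x : ginv (ginv x) = x.
Proof. symmetry. apply ginv_unique, gmulVl. Qed.

Lemma gidem x : gmul x x = x -> x = gone.
Proof. intros E. apply (gmul_injl x). now rewrite E, gmul1r. Qed.

Variable a : Aut G.

Lemma autpow_succ z g : autpow a (Z.succ z) g = a (autpow a z g).
Proof. exact (ziter_succ a (aut_inv a) z g (aut_funK a)). Qed.

(** Integer induction in both directions: as [a] is injective, the claims for [n] and [n + 1] are
    equivalent. *)
Lemma autpow_add n m g : autpow a (n + m) g = autpow a n (autpow a m g).
Proof.
  revert n. apply Z.bi_induction; auto.
  - intros x y ->. reflexivity.
  - intros n. rewrite Z.add_succ_l, !autpow_succ. split; intros E.
    + now rewrite E.
    + now rewrite <- (aut_invK a (autpow a (n + m) g)), E, aut_invK.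
Qed.

Lemma aut_inv_hom x y : aut_inv a (gmul x y) = gmul (aut_inv a x) (aut_inv a y).
Proof.
  rewrite <- (aut_funK a x), <- (aut_funK a y), <- aut_hom at 1.
  now rewrite !aut_invK.
Qed.

Lemma autpow_hom n x y : autpow a n (gmul x y) = gmul (autpow a n x) (autpow a n y).
Proof.
  revert n. apply Z.bi_induction; auto.
  - intros ? ? ->. reflexivity.
  - intros n. rewrite !autpow_succ. split; intros E.
    + now rewrite E, aut_hom.
    + now rewrite <- (aut_invK a (autpow a n (gmul x y))), E, aut_inv_hom, !aut_invK.
Qed.

Lemma autpow1 n : autpow a n gone = gone.
Proof. apply gidem. now rewrite <- autpow_hom, gmul1l. Qed.

Lemma autpowK n x : autpow a (- n) (autpow a n x) = x.
Proof. now rewrite <- autpow_add, Z.add_opp_diag_l. Qed.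

Lemma autpow_eq1 n x : autpow a n x = gone -> x = gone.
Proof. intros E. now rewrite <- (autpowK n x), E, autpow1. Qed.

Lemma autpow_inv n x : autpow a n (ginv x) = ginv (autpow a n x).
Proof. apply ginv_unique. now rewrite <- autpow_hom, gmulVr, autpow1. Qed.

End GroupFacts.

(** * Cones and prefix replacements *)

Definition zeros : cantor := fun _ => false.
Definition pre (n : nat) (x : cantor) : word := map x (seq 0 n).
Definition dropc (n : nat) (x : cantor) : cantor := fun i => x (n + i).

Lemma length_pre n x : length (pre n x) = n.
Proof. unfold pre. now rewrite length_map, length_seq. Qed.

Lemma nth_pre n x i : i < n -> nth i (pre n x) false = x i.
Proof.
  intros h. unfold pre. rewrite nth_indep with (d' := x 0).
  - rewrite map_nth, seq_nth; auto.
  - now rewrite length_map, length_seq.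
Qed.

Lemma wcat_lt m z i : i < length m -> wcat m z i = nth i m false.
Proof. intros h. unfold wcat. apply Nat.ltb_lt in h. now rewrite h. Qed.

Lemma wcat_ge m z i : wcat m z (length m + i) = z i.
Proof.
  unfold wcat. replace (length m + i <? length m) with false.
  - f_equal. lia.
  - symmetry. apply Nat.ltb_ge. lia.
Qed.

Lemma in_cyl_wcat m z : in_cyl m (wcat m z).
Proof. intros i h. now apply wcat_lt. Qed.

Lemma in_cyl_split m x : in_cyl m x -> x = wcat m (dropc (length m) x).
Proof.
  intros h. apply functional_extensionality. intros i.
  destruct (Nat.lt_ge_cases i (length m)) as [l|l].
  - rewrite wcat_lt by auto. now apply h.
  - replace i with (length m + (i - length m)) by lia. now rewrite wcat_ge.
Qed.

Lemma in_cyl_ex m x : in_cyl m x -> exists z, x = wcat m z.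
Proof. intros h. eexists. now apply in_cyl_split. Qed.

Lemma wcat_app m r z : wcat (m ++ r) z = wcat m (wcat r z).
Proof.
  apply functional_extensionality. intros i.
  destruct (Nat.lt_ge_cases i (length m)) as [l|l].
  - rewrite !wcat_lt; rewrite ?length_app; try lia. now rewrite app_nth1.
  - replace i with (length m + (i - length m)) by lia. set (j := i - length m).
    rewrite wcat_ge. destruct (Nat.lt_ge_cases j (length r)) as [k|k].
    + rewrite !wcat_lt; rewrite ?length_app; try lia.
      rewrite app_nth2 by lia. f_equal. lia.
    + replace (length m + j) with (length (m ++ r) + (j - length r))
        by (rewrite length_app; lia).
      replace j with (length r + (j - length r)) at 2 by lia.
      now rewrite !wcat_ge.
Qed.

Lemma wcat_inj m z z' : wcat m z = wcat m z' -> z = z'.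
Proof.
  intros E. apply functional_extensionality. intros i.
  now rewrite <- (wcat_ge m z i), <- (wcat_ge m z' i), E.
Qed.

Lemma in_cyl_pre n x y : in_cyl (pre n x) y <-> forall i, i < n -> y i = x i.
Proof.
  unfold in_cyl. rewrite length_pre. split; intros h i l.
  - now rewrite h, nth_pre.
  - rewrite nth_pre; auto.
Qed.

Lemma in_cyl_pre_self n x : in_cyl (pre n x) x.
Proof. now apply in_cyl_pre. Qed.

Lemma wcat_pre n x : wcat (pre n x) (dropc n x) = x.
Proof.
  symmetry. rewrite (in_cyl_split (pre n x) x (in_cyl_pre_self n x)) at 1.
  now rewrite length_pre.
Qed.

Lemma in_cyl_eq_pre m x : in_cyl m x -> m = pre (length m) x.
Proof.
  intros h. apply nth_ext with (d := false) (d' := false).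
  - now rewrite length_pre.
  - intros i l. rewrite nth_pre; auto. symmetry. now apply h.
Qed.

Lemma in_cyl_nil x : in_cyl [] x.
Proof. intros i h. inversion h. Qed.

Lemma in_cyl_app m r z : in_cyl (m ++ r) (wcat m z) <-> in_cyl r z.
Proof.
  split; intros h.
  - apply in_cyl_ex in h. destruct h as [y E]. rewrite wcat_app in E.
    apply wcat_inj in E. subst. apply in_cyl_wcat.
  - apply in_cyl_ex in h. destruct h as [y ->]. rewrite <- wcat_app.
    apply in_cyl_wcat.
Qed.

Lemma in_cyl_appl m r x : in_cyl (m ++ r) x -> in_cyl m x.
Proof.
  intros h. apply in_cyl_ex in h. destruct h as [z ->].
  rewrite wcat_app. apply in_cyl_wcat.
Qed.

Lemma in_cyl_agree m x y :
  in_cyl m x -> (forall i, i < length m -> y i = x i) -> in_cyl m y.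
Proof. intros h e i l. rewrite e; auto. Qed.

Lemma in_cyl_long m x p y :
  in_cyl m x -> in_cyl p x -> length m <= length p -> in_cyl p y -> in_cyl m y.
Proof.
  intros hm hp l hy. apply (in_cyl_agree m x); auto.
  intros i li. rewrite (hy i), (hp i); auto; lia.
Qed.

Lemma in_cyl_cons b m x : in_cyl (b :: m) x -> x 0 = b.
Proof. intros h. apply (h 0). simpl. lia. Qed.

Lemma in_cyl_both m p x : in_cyl m x -> in_cyl p x -> length m <= length p ->
  exists r, p = m ++ r.
Proof.
  intros hm hp l. apply in_cyl_ex in hm. destruct hm as [z ->].
  exists (pre (length p - length m) z).
  apply nth_ext with (d := false) (d' := false).
  - rewrite length_app, length_pre. lia.
  - intros i li. rewrite <- hp by auto.
    destruct (Nat.lt_ge_cases i (length m)) as [k|k].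
    + now rewrite wcat_lt, app_nth1.
    + rewrite app_nth2, nth_pre by lia.
      replace i with (length m + (i - length m)) at 1 by lia. apply wcat_ge.
Qed.

(** The coordinate just after [m] is free in [wcat m z], but would be fixed in [wcat p z] if [p]
    were longer. *)
Lemma wcat_len_le m p : (forall z, wcat m z = wcat p z) -> length p <= length m.
Proof.
  intros h. destruct (Nat.le_gt_cases (length p) (length m)) as [l|l]; auto.
  exfalso.
  pose proof (wcat_ge m (fun _ => true) 0) as A.
  pose proof (wcat_ge m (fun _ => false) 0) as B.
  rewrite h, wcat_lt in A by lia. rewrite h, wcat_lt in B by lia. congruence.
Qed.

Definition aff (v : cantor -> cantor) (m m' : word) : Prop :=
  forall z, v (wcat m z) = wcat m' z.

Lemma aff_app v m m' r : aff v m m' -> aff v (m ++ r) (m' ++ r).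
Proof. intros h z. now rewrite !wcat_app, h. Qed.

Lemma aff_comp v w m m' m'' : aff w m m' -> aff v m' m'' ->
  aff (fun x => v (w x)) m m''.
Proof. intros h k z. now rewrite h, k. Qed.

Fixpoint allwords (n : nat) : list word :=
  match n with
  | 0 => [[]]
  | S n => map (cons false) (allwords n) ++ map (cons true) (allwords n)
  end.

Lemma in_allwords n m : In m (allwords n) <-> length m = n.
Proof.
  revert m. induction n as [|n IH]; intros m; simpl.
  - split.
    + intros [<-|[]]; auto.
    + destruct m; simpl; auto; discriminate.
  - rewrite in_app_iff, !in_map_iff. split.
    + intros [[w [<- h]]|[w [<- h]]]; simpl; f_equal; now apply IH.
    + destruct m as [|b m]; simpl; [discriminate|]. intros [= h].
      apply IH in h. destruct b; [right|left]; eauto.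
Qed.

Lemma NoDup_allwords n : NoDup (allwords n).
Proof.
  induction n as [|n IH]; simpl.
  - repeat constructor; auto.
  - apply NoDup_app.
    + apply Injective_map_NoDup; auto. intros ? ? [=]; auto.
    + apply Injective_map_NoDup; auto. intros ? ? [=]; auto.
    + intros m. rewrite !in_map_iff. intros [w [<- _]] [w' [[=] _]].
Qed.

(** * Compactness of Cantor space *)

Section Compactness.
Variable P : word -> Prop.
Hypothesis P_app : forall m r, P m -> P (m ++ r).
Hypothesis P_loc : forall x, exists m, in_cyl m x /\ P m.

Let good (m : word) := exists n, forall r, length r = n -> P (m ++ r).

Lemma good_step m : good (m ++ [false]) -> good (m ++ [true]) -> good m.
Proof.
  intros [n0 h0] [n1 h1]. exists (S (n0 + n1)). intros r hr.
  destruct r as [|b r]; [discriminate|]. injection hr as hr.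
  replace (m ++ b :: r) with ((m ++ [b]) ++ r) by (now rewrite <- app_assoc).
  destruct b.
  - rewrite <- (firstn_skipn n1 r), app_assoc. apply P_app, h1.
    rewrite length_firstn. lia.
  - rewrite <- (firstn_skipn n0 r), app_assoc. apply P_app, h0.
    rewrite length_firstn. lia.
Qed.

Fixpoint badpath (n : nat) : word :=
  match n with
  | 0 => []
  | S n => let m := badpath n in
      if excluded_middle_informative (good (m ++ [false]))
      then m ++ [true] else m ++ [false]
  end.

(** Koenig's lemma: if no depth works, [badpath] runs through words that are not good, and [P_loc]
    fails at its limit. *)
Lemma uniform_depth : exists n, forall m, length m = n -> P m.
Proof.
  apply NNPP. intros hn.
  assert (B : forall n, ~ good (badpath n)).
  { induction n as [|n IH]; simpl.
    - intros [n h]. apply hn. now exists n.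
    - destruct (excluded_middle_informative _); auto.
      intros h. apply IH. now apply good_step. }
  assert (L : forall n, length (badpath n) = n).
  { induction n; simpl; auto.
    destruct (excluded_middle_informative _); rewrite length_app; simpl; lia. }
  set (x := fun i => nth i (badpath (S i)) false).
  assert (E : forall n, badpath n = pre n x).
  { induction n as [|n IH]; auto.
    apply nth_ext with (d := false) (d' := false).
    - now rewrite length_pre, L.
    - intros i hi. rewrite L in hi. rewrite nth_pre by auto.
      destruct (Nat.eq_dec i n) as [->|ne]; auto.
      transitivity (nth i (badpath n) false).
      + simpl. destruct (excluded_middle_informative _);
          rewrite app_nth1; rewrite ?L; auto; lia.
      + rewrite IH, nth_pre; auto; lia. }
  destruct (P_loc x) as [m [hm pm]]. apply (B (length m)).
  exists 0. intros r _. apply P_app. rewrite E, <- in_cyl_eq_pre; auto.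
Qed.
End Compactness.

(** * Elements of V as bijections given locally by prefix replacements *)

Lemma isV_loc v x : isV v -> exists m m', in_cyl m x /\ aff v m m'.
Proof.
  intros (ms & ms' & _ & p & _ & h). destruct (p x) as [k [[kl kc] _]].
  exists (nth k ms []), (nth k ms' []). split; auto. intros z. now apply h.
Qed.

Lemma isV_inj v x y : isV v -> v x = v y -> x = y.
Proof.
  intros (ms & ms' & hl & p & p' & h) E.
  destruct (p x) as [k [[kl kc] _]]. destruct (p y) as [j [[jl jc] _]].
  apply in_cyl_ex in kc, jc. destruct kc as [z ->]. destruct jc as [t ->].
  rewrite !h in E by auto.
  assert (k = j) as <-.
  { destruct (p' (wcat (nth k ms' []) z)) as [i [_ u]].
    transitivity i; [symmetry|]; apply u; (split; [congruence|]);
      [|rewrite E]; apply in_cyl_wcat. }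
  apply wcat_inj in E. now subst.
Qed.

Lemma isV_surj v y : isV v -> exists x, v x = y.
Proof.
  intros (ms & ms' & hl & p & p' & h).
  destruct (p' y) as [k [[kl kc] _]].
  apply in_cyl_ex in kc. destruct kc as [z ->].
  exists (wcat (nth k ms []) z). apply h. congruence.
Qed.

(** By compactness the local replacements exist at all words of one length [n]; these words form the
    source partition, and bijectivity makes their images a partition too. *)
Lemma isV_intro v :
  (forall x y, v x = v y -> x = y) -> (forall y, exists x, v x = y) ->
  (forall x, exists m m', in_cyl m x /\ aff v m m') -> isV v.
Proof.
  intros inj surj loc.
  destruct (uniform_depth (fun m => exists m', aff v m m')) as [n hn].
  - intros m r [m' h]. exists (m' ++ r). now apply aff_app.
  - intros x. destruct (loc x) as (m & m' & c & h). eauto.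
  - set (f := fun m => epsilon (inhabits []) (fun m' => aff v m m')).
    assert (hf : forall m, length m = n -> aff v m (f m)).
    { intros m l. apply (epsilon_spec (inhabits [])). auto. }
    assert (U : forall k, k < length (allwords n) ->
              length (nth k (allwords n) []) = n).
    { intros k l. apply in_allwords. now apply nth_In. }
    assert (K : forall k x, k < length (allwords n) ->
              in_cyl (nth k (allwords n) []) x ->
              nth k (allwords n) [] = pre n x).
    { intros k x l c. rewrite (in_cyl_eq_pre _ _ c). f_equal. auto. }
    assert (EX : forall x, exists k, k < length (allwords n) /\
              nth k (allwords n) [] = pre n x).
    { intros x. destruct (In_nth (allwords n) (pre n x) []) as [k [l e]]; eauto.
      apply in_allwords, length_pre. }
    assert (NF : forall k, k < length (allwords n) ->
              nth k (map f (allwords n)) [] = f (nth k (allwords n) [])).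
    { intros k l. rewrite nth_indep with (d' := f []).
      - apply map_nth.
      - now rewrite length_map. }
    assert (UQ : forall j k, j < length (allwords n) -> k < length (allwords n) ->
              nth j (allwords n) [] = nth k (allwords n) [] -> j = k).
    { intros j k lj lk. now apply NoDup_nth; auto using NoDup_allwords. }
    exists (allwords n), (map f (allwords n)). repeat split.
    + now rewrite length_map.
    + intros x. destruct (EX x) as [k [l e]]. exists k. split.
      * split; auto. rewrite e. apply in_cyl_pre_self.
      * intros j [jl jc]. apply UQ; auto. rewrite e. symmetry. auto.
    + intros y. destruct (surj y) as [x <-].
      destruct (EX x) as [k [l e]]. exists k. rewrite length_map. split.
      * split; auto. rewrite NF by auto.
        rewrite <- (wcat_pre n x), <- e at 1. rewrite hf by auto.
        apply in_cyl_wcat.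
      * intros j [jl jc]. rewrite NF in jc by auto.
        apply in_cyl_ex in jc. destruct jc as [z jc].
        rewrite <- hf in jc by auto. apply inj in jc.
        apply UQ; auto. rewrite e. symmetry. apply K; auto.
        rewrite jc. apply in_cyl_wcat.
    + intros k x l. rewrite NF by auto. now apply hf, U.
Qed.

Lemma isV_id : isV (fun x => x).
Proof.
  apply isV_intro; eauto. intros x. exists [], []. split.
  - apply in_cyl_nil.
  - now intros z.
Qed.

Lemma in_cyl_img v m m' x : in_cyl m x -> aff v m m' -> in_cyl m' (v x).
Proof.
  intros h a. apply in_cyl_ex in h. destruct h as [z ->]. rewrite a.
  apply in_cyl_wcat.
Qed.

(** The word [m] around [x] is lengthened until its image under [w] extends a word on which [v] is a
    replacement. *)
Lemma isV_loc2 v w x : isV v -> isV w ->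
  exists m m' m'', in_cyl m x /\ aff w m m' /\ aff v m' m''.
Proof.
  intros hv hw.
  destruct (isV_loc w x hw) as (m & m' & c & h).
  destruct (isV_loc v (w x) hv) as (p & p' & d & k).
  apply in_cyl_ex in c. destruct c as [z ->]. rewrite h in d.
  set (r := pre (length p) z).
  assert (cr : in_cyl r z) by apply in_cyl_pre_self.
  destruct (in_cyl_both p (m' ++ r) (wcat m' z)) as [s es]; auto.
  - now apply in_cyl_app.
  - rewrite length_app. unfold r. rewrite length_pre. lia.
  - exists (m ++ r), (m' ++ r), (p' ++ s). repeat split.
    + now apply in_cyl_app.
    + now apply aff_app.
    + rewrite es. now apply aff_app.
Qed.

Lemma isV_comp v w : isV v -> isV w -> isV (fun x => v (w x)).
Proof.
  intros hv hw. apply isV_intro.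
  - intros x y E. apply (isV_inj w); auto. now apply (isV_inj v).
  - intros y. destruct (isV_surj v y hv) as [z <-].
    destruct (isV_surj w z hw) as [x <-]. eauto.
  - intros x. destruct (isV_loc2 v w x hv hw) as (m & m' & m'' & c & h & k).
    exists m, m''. split; auto. now apply aff_comp with m'.
Qed.

Lemma VinvKr v x : isV v -> v (Vinv v x) = x.
Proof.
  intros h. unfold Vinv. apply (epsilon_spec (inhabits x) (fun y => v y = x)).
  now apply isV_surj.
Qed.

Lemma VinvK v x : isV v -> Vinv v (v x) = x.
Proof. intros h. apply (isV_inj v); auto. now apply VinvKr. Qed.

Lemma Vinv_eq v x y : isV v -> v x = y -> Vinv v y = x.
Proof. intros h <-. now apply VinvK. Qed.

Lemma aff_inv v m m' : isV v -> aff v m m' -> aff (Vinv v) m' m.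
Proof. intros h a z. apply Vinv_eq; auto. Qed.

Lemma isV_inv v : isV v -> isV (Vinv v).
Proof.
  intros h. apply isV_intro.
  - intros x y E. now rewrite <- (VinvKr v x), E, VinvKr.
  - intros y. exists (v y). now apply VinvK.
  - intros y. destruct (isV_loc v (Vinv v y) h) as (m & m' & c & a).
    exists m', m. split.
    + rewrite <- (VinvKr v y) by auto. eapply in_cyl_img; eauto.
    + now apply aff_inv.
Qed.

(** * Slopes and the chain rule *)

Definition slope (v : cantor -> cantor) (x : cantor) (s : Z) : Prop :=
  exists m m', in_cyl m x /\ aff v m m' /\
    s = (Z.of_nat (length m) - Z.of_nat (length m'))%Z.

(** Of two words around [x] one extends the other by some [r]; the images of the longer one then
    agree as cones, hence in length by [wcat_len_le]. *)
Lemma slope_fun v x s t : slope v x s -> slope v x t -> s = t.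
Proof.
  intros (m & m' & c & a & ->) (p & p' & d & b & ->).
  assert (W : forall m m' p p', in_cyl m x -> aff v m m' -> in_cyl p x ->
    aff v p p' -> length m <= length p ->
    (Z.of_nat (length m) - Z.of_nat (length m') =
     Z.of_nat (length p) - Z.of_nat (length p'))%Z).
  { clear. intros m m' p p' c a d b l.
    destruct (in_cyl_both m p x c d l) as [r ->].
    assert (E : forall z, wcat (m' ++ r) z = wcat p' z).
    { intros z. rewrite <- b. symmetry. now apply aff_app. }
    pose proof (wcat_len_le _ _ E).
    pose proof (wcat_len_le p' (m' ++ r) (fun z => eq_sym (E z))).
    rewrite length_app in *. lia. }
  destruct (Nat.le_ge_cases (length m) (length p)); [|symmetry]; eauto.
Qed.

Lemma slope_log2 v x : isV v -> slope v x (log2_slope v x).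
Proof.
  intros h. unfold log2_slope.
  apply (epsilon_spec (inhabits 0%Z) (fun z => slope v x z)).
  destruct (isV_loc v x h) as (m & m' & c & a). eexists. exists m, m'. eauto.
Qed.

Lemma log2_slope_eq v x s : isV v -> slope v x s -> log2_slope v x = s.
Proof. intros h k. eapply slope_fun; eauto using slope_log2. Qed.

Lemma slope_comp v w x s t : isV v -> isV w ->
  slope w x s -> slope v (w x) t -> slope (fun y => v (w y)) x (s + t).
Proof.
  intros hv hw h k.
  destruct (isV_loc2 v w x hv hw) as (m & m' & m'' & c & a & b).
  rewrite (slope_fun w x s (Z.of_nat (length m) - Z.of_nat (length m'))) by
    (auto; exists m, m'; auto).
  rewrite (slope_fun v (w x) t (Z.of_nat (length m') - Z.of_nat (length m''))).
  - exists m, m''. repeat split; auto.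
    + now apply aff_comp with m'.
    + lia.
  - auto.
  - exists m', m''. split; auto. eapply in_cyl_img; eauto.
Qed.

Lemma slope_inv v x s : isV v -> slope v x s -> slope (Vinv v) (v x) (- s).
Proof.
  intros h (m & m' & c & a & ->). exists m', m. repeat split.
  - eapply in_cyl_img; eauto.
  - now apply aff_inv.
  - lia.
Qed.

Lemma slope_id x : slope (fun y => y) x 0.
Proof.
  exists [], []. repeat split; auto using in_cyl_nil.
Qed.

Lemma log2_slope_comp v w x : isV v -> isV w ->
  log2_slope (fun y => v (w y)) x = (log2_slope v (w x) + log2_slope w x)%Z.
Proof.
  intros hv hw. apply log2_slope_eq; auto using isV_comp.
  rewrite Z.add_comm. apply slope_comp; auto using slope_log2.
Qed.

Lemma log2_slope_id x : log2_slope (fun y => y) x = 0%Z.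
Proof. apply log2_slope_eq; auto using isV_id, slope_id. Qed.

(** * Germs and cone swaps *)

Definition triv (v : cantor -> cantor) (x : cantor) : Prop :=
  exists m, in_cyl m x /\ aff v m m.

Lemma triv_fix v x : triv v x -> v x = x.
Proof.
  intros (m & c & a). apply in_cyl_ex in c. destruct c as [z ->]. apply a.
Qed.

Lemma triv_inv v x : isV v -> triv v x -> triv (Vinv v) x.
Proof. intros h (m & c & a). exists m. split; auto. now apply aff_inv. Qed.

Lemma triv_slope v x : triv v x -> slope v x 0.
Proof. intros (m & c & a). exists m, m. repeat split; auto. lia. Qed.

(** Slope [0] makes [m] and [m'] prefixes of the same point [x] of equal length, hence equal. *)
Lemma slope_triv v x : v x = x -> slope v x 0 -> triv v x.
Proof.
  intros e (m & m' & c & a & l). exists m. split; auto.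
  assert (d := in_cyl_img v m m' x c a). rewrite e in d.
  rewrite (in_cyl_eq_pre m' x d) in a. rewrite (in_cyl_eq_pre m x c) at 2.
  replace (length m) with (length m') by lia. exact a.
Qed.

Lemma slope_ex v x : isV v -> exists s, slope v x s.
Proof. intros h. eexists. now apply slope_log2. Qed.

Lemma triv_comp v w x : isV v -> isV w -> triv w x -> triv v x ->
  triv (fun y => v (w y)) x.
Proof.
  intros hv hw t u. apply slope_triv.
  - now rewrite (triv_fix w), (triv_fix v).
  - change 0%Z with (0 + 0)%Z. apply slope_comp; auto using triv_slope.
    rewrite triv_fix; auto using triv_slope.
Qed.

Lemma triv_conj v w x : isV v -> isV w -> triv w (v x) ->
  triv (fun y => Vinv v (w (v y))) x.
Proof.
  intros hv hw t. apply slope_triv.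
  - rewrite (triv_fix _ _ t). now apply VinvK.
  - destruct (slope_ex v x hv) as [s hs].
    replace 0%Z with (s + 0 + - s)%Z by lia.
    apply (slope_comp (Vinv v) (fun y => w (v y))); auto using isV_inv, isV_comp.
    + apply slope_comp; auto using triv_slope.
    + rewrite (triv_fix _ _ t). now apply slope_inv.
Qed.

Lemma V_continuous g z m : isV g -> in_cyl m (g z) ->
  exists p, in_cyl p z /\ forall y, in_cyl p y -> in_cyl m (g y).
Proof.
  intros h c. destruct (isV_loc g z h) as (p & p' & d & a).
  (* A coordinate [i < length m] of the image lies in [p'] or is read from a coordinate of the
     argument below [length p + length m]. *)
  exists (pre (length p + length m) z).
  split; [apply in_cyl_pre_self|]. intros y e.
  apply (in_cyl_agree m (g z)); auto. intros i l.
  assert (dy : in_cyl p y).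
  { apply (in_cyl_long p z (pre (length p + length m) z)); auto using in_cyl_pre_self.
    rewrite length_pre. lia. }
  rewrite (in_cyl_split p y), (in_cyl_split p z), !a by auto.
  destruct (Nat.lt_ge_cases i (length p')) as [k|k].
  - now rewrite !wcat_lt.
  - replace i with (length p' + (i - length p')) by lia. rewrite !wcat_ge.
    unfold dropc. apply (proj1 (in_cyl_pre _ _ _) e). lia.
Qed.

Lemma open_triv v x m : in_cyl m x -> (forall y, in_cyl m y -> v y = y) -> triv v x.
Proof. intros c h. exists m. split; auto. intros z. apply h, in_cyl_wcat. Qed.

Definition disj (p q : word) : Prop := forall x, in_cyl p x -> in_cyl q x -> False.

Lemma disj_sym p q : disj p q -> disj q p.
Proof. intros h x c d. eauto. Qed.

(** An involution when [p] and [q] are disjoint; the building block of the explicit elements of V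
    below. *)
Definition swap (p q : word) (x : cantor) : cantor :=
  if excluded_middle_informative (in_cyl p x) then wcat q (dropc (length p) x)
  else if excluded_middle_informative (in_cyl q x) then wcat p (dropc (length q) x)
  else x.

Lemma dropc_wcat m z : dropc (length m) (wcat m z) = z.
Proof. apply functional_extensionality. intros i. apply wcat_ge. Qed.

Lemma swap_l p q : aff (swap p q) p q.
Proof.
  intros z. unfold swap. destruct (excluded_middle_informative _) as [h|h].
  - now rewrite dropc_wcat.
  - exfalso. apply h, in_cyl_wcat.
Qed.

Lemma swap_r p q : disj p q -> aff (swap p q) q p.
Proof.
  intros d z. unfold swap. destruct (excluded_middle_informative _) as [h|h].
  - exfalso. apply (d (wcat q z)); auto using in_cyl_wcat.
  - destruct (excluded_middle_informative _) as [k|k].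
    + now rewrite dropc_wcat.
    + exfalso. apply k, in_cyl_wcat.
Qed.

Lemma swap_out p q x : ~ in_cyl p x -> ~ in_cyl q x -> swap p q x = x.
Proof.
  intros h k. unfold swap.
  destruct (excluded_middle_informative _); [contradiction|].
  destruct (excluded_middle_informative _); [contradiction|]. auto.
Qed.

Lemma swapK p q x : disj p q -> swap p q (swap p q x) = x.
Proof.
  intros d. destruct (classic (in_cyl p x)) as [h|h].
  { apply in_cyl_ex in h. destruct h as [z ->]. now rewrite swap_l, swap_r. }
  destruct (classic (in_cyl q x)) as [k|k].
  { apply in_cyl_ex in k. destruct k as [z ->]. now rewrite swap_r, swap_l. }
  now rewrite (swap_out p q x h k), swap_out.
Qed.

Lemma not_in_cyl_open p x : ~ in_cyl p x ->
  forall y, in_cyl (pre (length p) x) y -> ~ in_cyl p y.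
Proof.
  intros n y c d. apply n. apply (in_cyl_agree p y); auto.
  intros i l. symmetry. now apply (proj1 (in_cyl_pre _ _ _) c).
Qed.

Lemma swap_triv p q x : ~ in_cyl p x -> ~ in_cyl q x -> triv (swap p q) x.
Proof.
  intros h k. apply (open_triv _ _ (pre (length p + length q) x)).
  - apply in_cyl_pre_self.
  - intros y c. apply swap_out.
    + apply (not_in_cyl_open p x); auto.
      apply in_cyl_pre. intros i l. apply (proj1 (in_cyl_pre _ _ _) c). lia.
    + apply (not_in_cyl_open q x); auto.
      apply in_cyl_pre. intros i l. apply (proj1 (in_cyl_pre _ _ _) c). lia.
Qed.

Lemma isV_swap p q : disj p q -> isV (swap p q).
Proof.
  intros d. apply isV_intro.
  - intros x y E. now rewrite <- (swapK p q x), E, swapK.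
  - intros y. exists (swap p q y). now apply swapK.
  - intros x. destruct (classic (in_cyl p x)) as [h|h].
    { exists p, q. auto using swap_l. }
    destruct (classic (in_cyl q x)) as [k|k].
    { exists q, p. auto using swap_r. }
    destruct (swap_triv p q x h k) as (m & c & a). eauto.
Qed.

Lemma Vinv_swap p q x : disj p q -> Vinv (swap p q) x = swap p q x.
Proof. intros d. apply Vinv_eq; auto using isV_swap, swapK. Qed.

Lemma disj_cons b p q : disj (b :: p) (negb b :: q).
Proof.
  intros x c d. apply in_cyl_cons in c, d. destruct b; simpl in d; congruence.
Qed.

Lemma disj_app m p q : disj p q -> disj (m ++ p) (m ++ q).
Proof.
  intros h x c d. pose proof (in_cyl_appl _ _ _ c) as e.
  apply in_cyl_ex in e. destruct e as [z ->].
  apply in_cyl_app in c, d. eauto.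
Qed.

(** One letter per point of the list suffices, since at most one half of the current cone contains
    that point. *)
Lemma fresh_cone (L : list cantor) : exists r, forall x, In x L -> ~ in_cyl r x.
Proof.
  induction L as [|x L [r IH]].
  - exists []. intros x [].
  - destruct (classic (in_cyl (r ++ [false]) x)) as [h|h].
    + exists (r ++ [true]). intros y [<-|i] c.
      * apply (disj_app r [false] [true] (disj_cons false [] []) x); auto.
      * apply (IH y); auto. now apply in_cyl_appl in c.
    + exists (r ++ [false]). intros y [<-|i] c; auto.
      apply (IH y); auto. now apply in_cyl_appl in c.
Qed.

(** * Dyadic points and transitivity of V on them *)

Lemma in_Q2_zeros : in_Q2 zeros.
Proof. now exists 0. Qed.

Lemma in_Q2_wcat m z : in_Q2 (wcat m z) <-> in_Q2 z.
Proof.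
  split; intros [N h].
  - exists N. intros n l. rewrite <- (wcat_ge m). apply h. lia.
  - exists (length m + N). intros n l.
    replace n with (length m + (n - length m)) by lia. rewrite wcat_ge. apply h. lia.
Qed.

Lemma in_Q2_word x : in_Q2 x -> exists m, x = wcat m zeros.
Proof.
  intros [N h]. exists (pre N x). rewrite <- (wcat_pre N x) at 1. f_equal.
  apply functional_extensionality. intros i. apply h. lia.
Qed.

Lemma in_Q2_V v x : isV v -> in_Q2 x -> in_Q2 (v x).
Proof.
  intros hv h. destruct (isV_loc v x hv) as (m & m' & c & a).
  apply in_cyl_ex in c. destruct c as [z ->]. rewrite a.
  apply in_Q2_wcat. now apply in_Q2_wcat in h.
Qed.

Lemma fresh_Q2 (L : list cantor) : exists x, in_Q2 x /\ ~ In x L.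
Proof.
  destruct (fresh_cone L) as [r h]. exists (wcat r zeros). split.
  - apply in_Q2_wcat, in_Q2_zeros.
  - intros i. apply (h _ i), in_cyl_wcat.
Qed.

Lemma neq_differ (x y : cantor) : x <> y -> exists i, x i <> y i.
Proof.
  intros n. apply NNPP. intros h. apply n. apply functional_extensionality.
  intros i. apply NNPP. eauto.
Qed.

Lemma separate x (L : list cantor) : ~ In x L ->
  exists n, forall p y, in_cyl p x -> n <= length p -> In y L -> ~ in_cyl p y.
Proof.
  induction L as [|t L IH]; intros h.
  - exists 0. intros p y _ _ [].
  - destruct IH as [n hn]; [intros i; apply h; now right|].
    destruct (neq_differ x t) as [i hi]; [intros ->; apply h; now left|].
    exists (n + S i). intros p y c l [<-|j].
    + intros d. apply hi. rewrite (c i), (d i); auto; lia.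
    + apply hn; auto. lia.
Qed.

(** A small cone is carried to its image through a third, disjoint cone. *)
Lemma move m m' z (L : list cantor) : ~ In (wcat m z) L -> ~ In (wcat m' z) L ->
  exists u r, isV u /\ in_cyl r z /\ aff u (m ++ r) (m' ++ r) /\
    forall l, In l L -> triv u l.
Proof.
  intros hx hy. set (x := wcat m z) in *. set (y := wcat m' z) in *.
  (* The detour around [t] allows the cones at [x] and [y] to overlap, as they do in
     [contracting_ex]. *)
  destruct (fresh_Q2 (x :: y :: L)) as [t [_ ht]].
  destruct (separate x (t :: L)) as [n1 s1].
  { intros [<-|i]; auto. apply ht. now left. }
  destruct (separate y (t :: L)) as [n2 s2].
  { intros [<-|i]; auto. apply ht. right. now left. }
  destruct (separate t (x :: y :: L) ht) as [n3 s3].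
  (* Words of this length around [x] or [y] miss [t] and [L], and those around [t] miss [x], [y] and
     [L]. *)
  set (n := n1 + n2 + n3). set (r := pre n z).
  assert (cr : in_cyl r z) by apply in_cyl_pre_self.
  assert (lr : length r = n) by apply length_pre.
  assert (cx : in_cyl (m ++ r) x) by now apply in_cyl_app.
  assert (cy : in_cyl (m' ++ r) y) by now apply in_cyl_app.
  set (T := pre n t).
  assert (ct : in_cyl T t) by apply in_cyl_pre_self.
  assert (lT : length T = n) by apply length_pre.
  assert (D : forall w p, in_cyl p w -> n <= length p -> ~ in_cyl T w -> disj p T).
  { intros w p c l h s d e. apply h. intros i li. rewrite <- e by auto.
    rewrite (c i), (d i); auto; lia. }
  assert (d1 : disj (m ++ r) T).
  { apply (D x); auto. rewrite length_app; lia. apply s3; auto; [lia|now left]. }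
  assert (d2 : disj T (m' ++ r)).
  { apply disj_sym. apply (D y); auto. rewrite length_app; lia.
    apply s3; auto; [lia|right; now left]. }
  exists (fun w => swap T (m' ++ r) (swap (m ++ r) T w)), r.
  repeat split; auto using isV_comp, isV_swap.
  - apply aff_comp with T; apply swap_l.
  - intros l il.
    assert (nT : ~ in_cyl T l) by (apply s3; auto; [lia|now right; right]).
    apply (triv_comp (swap T (m' ++ r)) (swap (m ++ r) T)); auto using isV_swap;
      apply swap_triv; auto.
    + apply s1; auto. rewrite length_app; lia. now right.
    + apply s2; auto. rewrite length_app; lia. now right.
Qed.

(** Splits off from [v] a factor [u] with the same germ at [x] that does not disturb [L]. *)
Lemma move_germ v x L : isV v -> ~ In x L -> ~ In (v x) L ->
  exists u, isV u /\ triv (fun y => Vinv u (v y)) x /\ forall l, In l L -> triv u l.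
Proof.
  intros hv hx hy. destruct (isV_loc v x hv) as (m & m' & c & a).
  apply in_cyl_ex in c. destruct c as [z ->]. rewrite a in hy.
  destruct (move m m' z L hx hy) as (u & r & hu & cr & au & tu).
  exists u. repeat split; auto. exists (m ++ r). split.
  - now apply in_cyl_app.
  - apply aff_comp with (m' ++ r).
    + now apply aff_app.
    + now apply aff_inv.
Qed.

Lemma move_point x y L : in_Q2 x -> in_Q2 y -> ~ In x L -> ~ In y L ->
  exists u, isV u /\ u x = y /\ forall l, In l L -> triv u l.
Proof.
  intros qx qy hx hy.
  apply in_Q2_word in qx, qy. destruct qx as [m ->]. destruct qy as [m' ->].
  destruct (move m m' zeros L hx hy) as (u & r & hu & cr & au & tu).
  exists u. repeat split; auto.
  rewrite (in_cyl_split r zeros cr), <- !wcat_app. apply au.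
Qed.

(** Points are moved one at a time to fresh places, by elements trivial near the points already
    moved. *)
Lemma move_off (E F : list cantor) : (forall e, In e E -> in_Q2 e) ->
  exists w, isV w /\ forall e, In e E -> ~ In (w e) F.
Proof.
  induction E as [|e E IH]; intros hE.
  - exists (fun x => x). split; [apply isV_id|]. intros e [].
  - destruct IH as [w [hw h]]; [intros f i; apply hE; now right|].
    destruct (classic (In (w e) F)) as [i|i].
    + destruct (fresh_Q2 (F ++ map w E)) as [t [qt ht]].
      rewrite in_app_iff in ht.
      destruct (move_point (w e) t (map w E)) as (u & hu & ut & tu); auto.
      * apply in_Q2_V; auto. apply hE. now left.
      * intros j. apply in_map_iff in j. destruct j as [e' [j1 j2]].
        apply (h e'); auto. congruence.
      * exists (fun x => u (w x)). split; [now apply isV_comp|].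
        intros f [<-|j].
        -- rewrite ut. tauto.
        -- rewrite triv_fix; auto. apply tu. now apply in_map.
    + exists w. split; auto. intros f [<-|j]; auto.
Qed.

Lemma disj_long (x y : cantor) : x <> y -> exists k, forall p q,
  in_cyl p x -> in_cyl q y -> k <= length p -> k <= length q -> disj p q.
Proof.
  intros h. destruct (neq_differ x y h) as [i hi]. exists (S i).
  intros p q c d lp lq z cz dz. apply hi.
  rewrite (c i), (d i), <- (cz i), <- (dz i); auto; lia.
Qed.

(** Both words are nonempty, so if their first letters agree, the opposite half is disjoint from
    both cones and serves as a stopover. *)
Lemma cone_to_cone b p c q : exists g, isV g /\ aff g (b :: p) (c :: q).
Proof.
  destruct (Bool.bool_dec c (negb b)) as [->|e].
  - exists (swap (b :: p) (negb b :: q)). split.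
    + apply isV_swap, disj_cons.
    + apply swap_l.
  - replace c with b by (destruct b, c; simpl in *; congruence).
    assert (d1 := disj_cons b p []). assert (d2 := disj_cons b q []).
    apply disj_sym in d2.
    exists (fun x => swap [negb b] (b :: q) (swap (b :: p) [negb b] x)). split.
    + auto using isV_comp, isV_swap.
    + apply aff_comp with [negb b]; apply swap_l.
Qed.

(** Serves as an element of V whose support is exactly the cone of [M]. *)
Definition swap_halves (M : word) : cantor -> cantor :=
  swap (M ++ [false]) (M ++ [true]).

Lemma disj_halves M : disj (M ++ [false]) (M ++ [true]).
Proof. apply disj_app, (disj_cons false). Qed.

Lemma isV_swap_halves M : isV (swap_halves M).
Proof. apply isV_swap, disj_halves. Qed.

Lemma swap_halves_in M y : in_cyl M y ->
  in_cyl M (swap_halves M y) /\ swap_halves M y <> y.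
Proof.
  intros h. assert (d := disj_halves M).
  assert (k : in_cyl (M ++ [false]) y \/ in_cyl (M ++ [true]) y).
  { apply in_cyl_ex in h. destruct h as [w ->].
    destruct (w 0) eqn:e; [right|left]; apply in_cyl_app; intros i li;
      simpl in li; replace i with 0 by lia; auto. }
  unfold swap_halves. destruct k as [k|k]; apply in_cyl_ex in k;
    destruct k as [w ->]; [rewrite swap_l|rewrite swap_r by auto];
    (split; [rewrite wcat_app; apply in_cyl_wcat|]); intros e;
    apply (d (wcat (M ++ [false]) w)); try apply in_cyl_wcat;
    [rewrite <- e|rewrite e]; apply in_cyl_wcat.
Qed.

Lemma swap_halves_out M y : ~ in_cyl M y -> swap_halves M y = y.
Proof.
  intros h. apply swap_out; intros k; apply h; now apply in_cyl_appl in k.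
Qed.

Lemma iter_inj (k : cantor -> cantor) j x y :
  (forall x y, k x = k y -> x = y) -> Nat.iter j k x = Nat.iter j k y -> x = y.
Proof. intros h. induction j; simpl; auto. Qed.

Lemma iter_commute (u k : cantor -> cantor) j x :
  (forall y, u (k y) = k (u y)) -> u (Nat.iter j k x) = Nat.iter j k (u x).
Proof. intros h. induction j as [|j IH]; simpl; auto. now rewrite h, IH. Qed.

(** * Normal subgroups of V *)

(** Pointwise form of the condition that the set of moved points is clopen. *)
Definition clopen_support (u : cantor -> cantor) : Prop :=
  forall z, (exists m, in_cyl m z /\ forall y, in_cyl m y -> u y = y) \/
            (exists m, in_cyl m z /\ forall y, in_cyl m y -> u y <> y).

Lemma clopen_support_conj u g : isV g -> clopen_support u ->
  clopen_support (fun x => g (u (Vinv g x))).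
Proof.
  intros hg hu z.
  destruct (hu (Vinv g z)) as [(m & c & h)|(m & c & h)]; [left|right];
    destruct (V_continuous (Vinv g) z m (isV_inv g hg) c) as (p & d & k);
    exists p; split; auto; intros y e.
  - now rewrite h, VinvKr by auto.
  - intros E. apply (h (Vinv g y)); auto. rewrite <- E at 2. now rewrite VinvK.
Qed.

(** All points of the cone are attracted by [k] to [p.000...], so its commutation
    with [u] spreads the behaviour of [u] near that point to the whole cone. *)
Lemma contraction_homogeneous u k p : clopen_support u ->
  (forall x y, k x = k y -> x = y) -> (forall y, u (k y) = k (u y)) ->
  aff k p (p ++ [false]) ->
  (forall y, in_cyl p y -> u y = y) \/ (forall y, in_cyl p y -> u y <> y).
Proof.
  intros hu inj cm a.
  assert (it : forall j z, Nat.iter j k (wcat p z) = wcat (p ++ repeat false j) z).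
  { induction j as [|j IH]; intros z; simpl.
    - now rewrite app_nil_r.
    - now rewrite IH, wcat_app, a, <- !wcat_app, <- app_assoc. }
  assert (near : forall m z, in_cyl m (wcat p zeros) ->
            in_cyl m (Nat.iter (length m) k (wcat p z))).
  { intros m z c. rewrite it.
    apply (in_cyl_long m (wcat p zeros) (p ++ repeat false (length m))); auto.
    - apply in_cyl_app. intros i _. now rewrite nth_repeat.
    - rewrite length_app, repeat_length. lia.
    - apply in_cyl_wcat. }
  destruct (hu (wcat p zeros)) as [(m & c & h)|(m & c & h)]; [left|right];
    intros y d; apply in_cyl_ex in d; destruct d as [z ->].
  - apply (iter_inj k (length m)); auto. rewrite <- iter_commute by auto.
    apply h. auto.
  - intros E. apply (h (Nat.iter (length m) k (wcat p z))); auto.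
    now rewrite iter_commute, E by auto.
Qed.

Section NormalSubgroup.
Variable N : (cantor -> cantor) -> Prop.
Hypothesis N_V : forall n, N n -> isV n.
Hypothesis N_mul : forall n n', N n -> N n' -> N (fun x => n (n' x)).
Hypothesis N_inv : forall n, N n -> N (Vinv n).
Hypothesis N_conj : forall n g, N n -> isV g -> N (fun x => g (n (Vinv g x))).
(** Holds for the image of the direct sum, where supports can be moved apart; the three elements
    will be three contractions. *)
Hypothesis N_comm : forall n1 n2 n3 n', N n1 -> N n2 -> N n3 -> N n' ->
  exists g, isV g /\ forall n, n = n1 \/ n = n2 \/ n = n3 ->
    forall x, g (n' (Vinv g (n x))) = n (g (n' (Vinv g x))).

Let commutator (f n : cantor -> cantor) (x : cantor) := f (n (Vinv f (Vinv n x))).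

Lemma N_commutator f n : isV f -> N n -> N (commutator f n).
Proof. intros hf hn. apply (N_mul (fun x => f (n (Vinv f x)))); auto. Qed.

(** If [n] moves [x], it takes a small cone [M] to a disjoint cone [M']. Commutators with [n] put
    into [N] a contraction and an involution with support the union of [M] and [M']. A conjugate [u]
    of the involution that commutes with contractions of the cones [0], [1] and of the union of [00]
    and [10] is trivial or free of fixed points on each of these sets. As the third meets the other
    two, [u] is trivial or free of fixed points everywhere, but it is neither. *)
Lemma commuting_normal_trivial n x : N n -> n x = x.
Proof.
  intros hN. apply NNPP. intros hx. assert (hn := N_V _ hN).
  destruct (fresh_Q2 [x; n x]) as [t [_ ht]].
  destruct (isV_loc n x hn) as (m & m' & c & a).
  apply in_cyl_ex in c. destruct c as [z ->].
  set (x := wcat m z) in *.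
  destruct (disj_long x (n x) (not_eq_sym hx)) as [k1 h1].
  destruct (separate x [t]) as [k2 h2].
  { intros [e|[]]. apply ht. subst t. now left. }
  destruct (separate (n x) [t]) as [k3 h3].
  { intros [e|[]]. apply ht. subst t. right. now left. }
  (* The successor makes [M] nonempty, as [cone_to_cone] requires; the point [t] outside both cones
     will be fixed by the involution. *)
  set (r := pre (S (k1 + k2 + k3)) z).
  assert (lr : length r = S (k1 + k2 + k3)) by apply length_pre.
  assert (cr : in_cyl r z) by apply in_cyl_pre_self.
  remember (m ++ r) as M eqn:EM. remember (m' ++ r) as M' eqn:EM'.
  assert (aM : aff n M M') by (subst M M'; now apply aff_app).
  assert (cM : in_cyl M x) by (subst M; now apply in_cyl_app).
  assert (cM' : in_cyl M' (n x)) by now apply in_cyl_img with M.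
  assert (lM : S (k1 + k2 + k3) <= length M) by (subst M; rewrite length_app; lia).
  assert (lM' : S (k1 + k2 + k3) <= length M') by (subst M'; rewrite length_app; lia).
  assert (dM : disj M M') by (apply h1; auto; lia).
  assert (tM : ~ in_cyl M t) by (apply h2; auto; [lia|now left]).
  assert (tM' : ~ in_cyl M' t) by (apply h3; auto; [lia|now left]).
  clear h1 h2 h3 EM EM' cr lr r lM'.
  destruct M as [|b M0] eqn:EM; [simpl in lM; lia|]. rewrite <- EM in *. clear lM.
  assert (iM : forall y, in_cyl M (Vinv n y) -> in_cyl M' y).
  { intros y h. rewrite <- (VinvKr n y) by auto. now apply in_cyl_img with M. }
  (* On [M] the commutator acts as [f], because [Vinv n y] lies outside [M], where [f] is the
     identity. *)
  assert (cf : forall f y, isV f -> (forall y, ~ in_cyl M y -> f y = y) ->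
            in_cyl M y -> commutator f n y = f y).
  { intros f y hf sf h. unfold commutator.
    assert (k : ~ in_cyl M (Vinv n y)) by (intros k; apply (dM y); auto).
    rewrite (Vinv_eq f (Vinv n y) (Vinv n y)) by auto. now rewrite VinvKr. }
  assert (d01 : disj (M ++ [false]) (M ++ [true])) by apply disj_app, (disj_cons false).
  assert (d100 : disj (M ++ [true]) (M ++ [false; false]))
    by apply disj_app, (disj_cons true).
  assert (out : forall q y, ~ in_cyl M y -> ~ in_cyl (M ++ q) y).
  { intros q y h k. apply h. now apply in_cyl_appl in k. }
  (* contracts the cone [M0] to [M00], through [M1] *)
  set (f := fun y => swap (M ++ [true]) (M ++ [false; false])
                       (swap (M ++ [false]) (M ++ [true]) y)).
  assert (hf : isV f) by (unfold f; auto using isV_comp, isV_swap).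
  assert (sf : forall y, ~ in_cyl M y -> f y = y).
  { intros y h. unfold f. rewrite (swap_out (M ++ [false])) by auto.
    now apply swap_out; auto. }
  set (F := commutator f n).
  assert (NF : N F) by now apply N_commutator.
  assert (aF : aff F (M ++ [false]) ((M ++ [false]) ++ [false])).
  { intros y. unfold F. rewrite cf; auto.
    - rewrite <- app_assoc. apply aff_comp with (M ++ [true]); apply swap_l.
    - rewrite wcat_app. apply in_cyl_wcat. }
  set (s := swap_halves M).
  assert (hs : isV s) by apply isV_swap_halves.
  assert (ss : forall y, ~ in_cyl M y -> s y = y) by apply swap_halves_out.
  assert (ms : forall y, in_cyl M y -> in_cyl M (s y) /\ s y <> y)
    by apply swap_halves_in.
  (* an involution whose support is the union of the cones [M] and [M'] *)
  set (u' := commutator s n).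
  assert (Nu : N u') by now apply N_commutator.
  assert (uM : forall y, in_cyl M y -> u' y <> y).
  { intros y h. unfold u'. rewrite cf; auto. now apply ms. }
  assert (uM' : forall y, in_cyl M' y -> u' y <> y).
  { intros y h E. unfold u', commutator in E.
    replace (Vinv s (Vinv n y)) with (s (Vinv n y)) in E
      by (symmetry; now apply Vinv_swap).
    set (q := Vinv n y) in *.
    assert (cq : in_cyl M q) by (apply in_cyl_img with M'; auto using aff_inv).
    destruct (ms q cq) as [k1' k2'].
    rewrite (ss (n (s q))) in E.
    - apply k2'. apply (isV_inj n); auto. rewrite E. unfold q. now rewrite VinvKr.
    - intros k. apply (dM _ k). now apply in_cyl_img with M. }
  assert (uo : forall y, ~ in_cyl M y -> ~ in_cyl M' y -> u' y = y).
  { intros y h h'. unfold u', commutator.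
    rewrite (Vinv_eq s (Vinv n y) (Vinv n y)), VinvKr by auto. auto. }
  assert (pu : clopen_support u').
  { intros y. destruct (classic (in_cyl M y)) as [h|h]; [right; eauto|].
    destruct (classic (in_cyl M' y)) as [h'|h']; [right; eauto|].
    left. exists (pre (length M + length M') y). split; [apply in_cyl_pre_self|].
    intros w cw. apply uo.
    - apply (not_in_cyl_open M y); auto. apply in_cyl_pre. intros i li.
      apply (proj1 (in_cyl_pre _ _ _) cw). lia.
    - apply (not_in_cyl_open M' y); auto. apply in_cyl_pre. intros i li.
      apply (proj1 (in_cyl_pre _ _ _) cw). lia. }
  (* Conjugation transports the contraction [F] from [M0] to either half of Cantor space. *)
  assert (conjF : forall e, exists k, N k /\ aff k [e] [e; false]).
  { intros e. destruct (cone_to_cone b (M0 ++ [false]) e []) as (g & hg & ag).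
    replace (b :: M0 ++ [false]) with (M ++ [false]) in ag by now rewrite EM.
    exists (fun y => g (F (Vinv g y))). split; auto. intros y.
    rewrite (aff_inv g _ _ hg ag), aF. apply (aff_app _ _ _ [false] ag). }
  destruct (conjF false) as (n1 & N1 & a1). destruct (conjF true) as (n2 & N2 & a2).
  (* The map [h] takes the cone [0] to the union of [00] and [10], which [n3] therefore contracts
     and which meets both halves. *)
  set (h := swap [false; true] [true; false]).
  assert (dh : disj [false; true] [true; false]) by apply disj_cons.
  assert (hh : isV h) by now apply isV_swap.
  set (n3 := fun y => h (n1 (Vinv h y))).
  assert (N3 : N n3) by now apply N_conj.
  destruct (N_comm n1 n2 n3 u') as (g & hg & cm); auto.
  set (u := fun y => g (u' (Vinv g y))) in *.
  assert (pg : clopen_support u) by now apply clopen_support_conj.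
  (* Pulling [u] back by [h] turns its behaviour on the union of [00] and [10] into that of [u2] on
     a single cone. *)
  set (u2 := fun y => Vinv h (u (Vinv (Vinv h) y))).
  assert (pg2 : clopen_support u2) by (apply clopen_support_conj; auto using isV_inv).
  assert (Vh : forall y, Vinv (Vinv h) y = h y)
    by (intros y; apply Vinv_eq; auto using isV_inv, VinvK).
  assert (uf : forall y, u2 y = y <-> u (h y) = h y).
  { intros y. unfold u2. rewrite Vh. split; intros e.
    - rewrite <- e at 2. now rewrite VinvKr.
    - rewrite e. now apply VinvK. }
  assert (inj : forall k, N k -> forall y y', k y = k y' -> y = y')
    by (intros k hk y y'; apply isV_inj; auto).
  assert (H1 := contraction_homogeneous u n1 [false] pg (inj _ N1)
    (cm n1 (or_introl eq_refl)) a1).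
  assert (H2 := contraction_homogeneous u n2 [true] pg (inj _ N2)
    (cm n2 (or_intror (or_introl eq_refl))) a2).
  assert (H3 : (forall y, in_cyl [false] y -> u2 y = y) \/
               (forall y, in_cyl [false] y -> u2 y <> y)).
  { apply (contraction_homogeneous u2 n1 [false] pg2 (inj _ N1)); auto.
    intros y. unfold u2. rewrite !Vh.
    assert (e : h (n1 y) = n3 (h y)) by (unfold n3; now rewrite VinvK).
    assert (e' := cm n3 (or_intror (or_intror eq_refl)) (h y)).
    change (u (n3 (h y)) = n3 (u (h y))) in e'.
    rewrite e, e'. unfold n3. now rewrite VinvK. }
  assert (p00 : h (wcat [false; false] zeros) = wcat [false; false] zeros).
  { apply swap_out; intros i.
    - specialize (i 1). simpl in i. discriminate i. lia.
    - specialize (i 0). simpl in i. discriminate i. lia. }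
  assert (p01 : h (wcat [false; true] zeros) = wcat [true; false] zeros)
    by apply swap_l.
  assert (c00 : in_cyl [false] (wcat [false; false] zeros))
    by apply (in_cyl_appl [false] [false]), in_cyl_wcat.
  assert (c01 : in_cyl [false] (wcat [false; true] zeros))
    by apply (in_cyl_appl [false] [true]), in_cyl_wcat.
  assert (c10 : in_cyl [true] (wcat [true; false] zeros))
    by apply (in_cyl_appl [true] [false]), in_cyl_wcat.
  assert (q00 := uf (wcat [false; false] zeros)). rewrite p00 in q00.
  assert (q01 := uf (wcat [false; true] zeros)). rewrite p01 in q01.
  assert (all : forall y, in_cyl [false] y \/ in_cyl [true] y).
  { intros y. destruct (y 0) eqn:e; [right|left]; intros i li;
      simpl in li; replace i with 0 by lia; auto. }
  assert (ft : u (g t) = g t) by (unfold u; now rewrite VinvK, uo).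
  assert (fm : u (g x) <> g x).
  { unfold u. rewrite VinvK by auto. intros e. apply (isV_inj g) in e; auto.
    now apply (uM x). }
  (* In the mixed cases [H3] would make [u] behave alike at a point of each half; the uniform cases
     contradict the moved point [g x] or the fixed point [g t]. *)
  destruct H1 as [H1|H1], H2 as [H2|H2].
  - destruct (all (g x)) as [i|i]; [apply fm, (H1 _ i)|apply fm, (H2 _ i)].
  - destruct H3 as [H3|H3].
    + apply (H2 _ c10), q01, (H3 _ c01).
    + apply (H3 _ c00), q00, (H1 _ c00).
  - destruct H3 as [H3|H3].
    + apply (H1 _ c00), q00, (H3 _ c00).
    + apply (H3 _ c01), q01, (H2 _ c10).
  - destruct (all (g t)) as [i|i]; [apply (H1 _ i ft)|apply (H2 _ i ft)].
Qed.
End NormalSubgroup.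

(** * Stabilisers, slopes and automorphisms of V *)

Definition Vsubgroup (H : (cantor -> cantor) -> Prop) : Prop :=
  (forall v w, isV v -> isV w -> H v -> H w -> H (fun x => v (w x))) /\
  (forall v, isV v -> H v -> H (Vinv v)).

(** The inclusion [T_F <= H] of the overview. *)
Definition contains_triv (F : list cantor) (H : (cantor -> cantor) -> Prop) : Prop :=
  forall v, isV v -> (forall f, In f F -> triv v f) -> H v.

Lemma Vsubgroup_cancel H u v : Vsubgroup H -> isV u -> isV v -> H u ->
  H (fun x => Vinv u (v x)) -> H v.
Proof.
  intros [hm hi] hu hv Hu K.
  replace v with (fun x => u (Vinv u (v x))).
  - apply (hm u (fun x => Vinv u (v x))); auto using isV_comp, isV_inv.
  - apply functional_extensionality. intros x. now apply VinvKr.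
Qed.

(** If [v x] is not in [F'], [move_germ] factors [v] into an element trivial near [F'] and one
    trivial near [x :: F1], both in [H]. Otherwise an element trivial near [x :: F1] first takes
    [v x] to a fresh point. *)
Lemma contains_triv_drop H x F1 F' : Vsubgroup H -> in_Q2 x ->
  contains_triv (x :: F1) H -> contains_triv F' H ->
  ~ In x F1 -> ~ In x F' -> contains_triv F1 H.
Proof.
  intros sg qx hF hF' n1 n'.
  assert (W : forall v, isV v -> (forall f, In f F1 -> triv v f) ->
    ~ In (v x) F' -> H v).
  { intros v hv tv nv.
    destruct (move_germ v x (F' ++ F1)) as (u & hu & tu & tL); auto.
    - rewrite in_app_iff. tauto.
    - rewrite in_app_iff. intros [i|i]; auto.
      apply n1. replace x with (v x); auto.
      apply (isV_inj v); auto. now apply triv_fix, tv.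
    - apply (Vsubgroup_cancel H u v); auto.
      + apply hF'; auto. intros f i. apply tL, in_app_iff. auto.
      + apply hF; auto using isV_comp, isV_inv.
        intros f [<-|i]; auto.
        apply (triv_comp (Vinv u) v); auto using isV_inv.
        apply triv_inv; auto. apply tL, in_app_iff. auto. }
  intros v hv tv. destruct (classic (In (v x) F')) as [i|i]; auto.
  destruct (fresh_Q2 (F' ++ x :: F1)) as [t [qt ht]]. rewrite in_app_iff in ht.
  destruct (move_point (v x) t (x :: F1)) as (u & hu & ut & tu); auto.
  - now apply in_Q2_V.
  - intros [e|j].
    + apply n'. now rewrite e.
    + apply n1. replace x with (v x); auto.
      apply (isV_inj v); auto. now apply triv_fix, tv.
  - assert (Hu : H (fun y => u (v y))).
    { apply W; auto using isV_comp.
      - intros f j. apply (triv_comp u v); auto. apply tu. now right.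
      - rewrite ut. tauto. }
    apply (Vsubgroup_cancel H (Vinv u) v); auto using isV_inv.
    + apply sg; auto.
    + replace (fun y => Vinv (Vinv u) (v y)) with (fun y => u (v y)); auto.
      apply functional_extensionality. intros y. symmetry.
      apply Vinv_eq; auto using isV_inv, VinvK.
Qed.

(** Conjugation by [h] carries [T_F] to [T_(h F)] and preserves [H]. *)
Lemma contains_triv_map H h F : Vsubgroup H -> isV h -> H h ->
  contains_triv F H -> contains_triv (map h F) H.
Proof.
  intros [hm hi] hh Hh hF v hv tv.
  replace v with (fun x => h ((fun y => Vinv h (v (h y))) (Vinv h x))).
  - assert (isV (fun y => Vinv h (v (h y))))
      by (apply (isV_comp (Vinv h) (fun y => v (h y))); auto using isV_inv, isV_comp).
    apply (hm h); auto.
    + apply (isV_comp (fun y => Vinv h (v (h y)))); auto using isV_inv.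
    + apply (hm (fun y => Vinv h (v (h y)))); auto using isV_inv.
      apply hF; auto. intros f i. apply triv_conj; auto. apply tv. now apply in_map.
  - apply functional_extensionality. intros x. now rewrite !VinvKr.
Qed.

Lemma contains_triv_incl F F' H : (forall x, In x F' -> In x F) ->
  contains_triv F' H -> contains_triv F H.
Proof. intros e h v hv t. apply h; auto. Qed.

(** If some [h] in [H] moves [f] out of [F], then the point [h f] can be dropped
    from [h F]; so an [F] of minimal length is preserved. *)
Lemma Vsubgroup_core H F : Vsubgroup H -> (forall v, H v -> isV v) -> NoDup F ->
  (forall f, In f F -> in_Q2 f) -> contains_triv F H ->
  exists F0, NoDup F0 /\ (forall f, In f F0 -> in_Q2 f) /\ contains_triv F0 H /\
    forall h f, H h -> In f F0 -> In (h f) F0.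
Proof.
  intros sg HV.
  remember (length F) as n eqn:En. revert F En.
  induction n as [n IH] using lt_wf_ind. intros F En nd q tf.
  destruct (classic (forall h f, H h -> In f F -> In (h f) F)) as [k|k].
  { exists F. auto. }
  apply not_all_ex_not in k. destruct k as [h k].
  apply not_all_ex_not in k. destruct k as [f k].
  assert (Hh : H h) by tauto. assert (iF : In f F) by tauto.
  assert (nF : ~ In (h f) F) by tauto. clear k.
  assert (Vh := HV h Hh).
  destruct (in_split f F iF) as (l1 & l2 & EF).
  assert (ndm : NoDup (map h F)).
  { apply Injective_map_NoDup; auto. intros a b. now apply isV_inj. }
  assert (tfm := contains_triv_map H h F sg Vh Hh tf).
  assert (qm : forall y, In y (map h F) -> in_Q2 y).
  { intros y i. apply in_map_iff in i. destruct i as [w [<- i]].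
    apply in_Q2_V; auto. }
  assert (EM : map h F = map h l1 ++ h f :: map h l2) by (rewrite EF; apply map_app).
  rewrite EM in ndm, tfm, qm.
  apply (IH (length (map h l1 ++ map h l2))) with (map h l1 ++ map h l2); auto.
  - rewrite En, <- (length_map h F), EM, !length_app. simpl. lia.
  - now apply NoDup_remove_1 in ndm.
  - intros y i. apply qm. rewrite in_app_iff in *. simpl. tauto.
  - apply (contains_triv_drop H (h f) _ F); auto.
    + apply in_Q2_V; auto.
    + apply (contains_triv_incl _ (map h l1 ++ h f :: map h l2)); auto.
      intros y i. rewrite in_app_iff in i. simpl in *. rewrite in_app_iff. tauto.
    + now apply NoDup_remove_2 in ndm.
Qed.

(** With [T_x] the subgroup contains its conjugate [T_(h x)]; as the two points differ,
    [contains_triv_drop] leaves the empty list. *)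
Lemma stabiliser_maximal H x h : Vsubgroup H -> in_Q2 x -> contains_triv [x] H ->
  isV h -> H h -> h x <> x -> forall v, isV v -> H v.
Proof.
  intros sg q tf hh Hh ne v hv.
  apply (contains_triv_drop H (h x) [] [x]); auto.
  - now apply in_Q2_V.
  - apply (contains_triv_map H h [x]); auto.
  - intros [e|[]]; congruence.
  - intros f [].
Qed.

Lemma V_moves_finite F x : in_Q2 x -> exists u, isV u /\ ~ In (u x) F.
Proof.
  intros q. destruct (move_off [x] F) as (w & hw & h).
  - now intros e [<-|[]].
  - exists w. split; auto. apply h. now left.
Qed.

Lemma moved_open w x : isV w -> w x <> x ->
  exists p, in_cyl p x /\ forall y, in_cyl p y -> w y <> y.
Proof.
  intros hw h. destruct (disj_long x (w x) (not_eq_sym h)) as [k hk].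
  destruct (V_continuous w x (pre k (w x)) hw (in_cyl_pre_self _ _)) as (p & c & d).
  exists (pre (k + length p) x). split; [apply in_cyl_pre_self|]. intros y e E.
  apply (hk (pre (k + length p) x) (pre k (w x))) with y; auto using in_cyl_pre_self;
    rewrite ?length_pre; try lia.
  rewrite <- E. apply d. apply (in_cyl_long p x (pre (k + length p) x));
    auto using in_cyl_pre_self. rewrite length_pre. lia.
Qed.

(** * Germs and slopes read off from fixed points in Q_2 *)

Lemma fix_dense v p : isV v -> (forall y, in_Q2 y -> in_cyl p y -> v y = y) ->
  forall y, in_cyl p y -> v y = y.
Proof.
  intros hv h y c. apply NNPP. intros ne.
  destruct (moved_open v y hv ne) as (q & d & k).
  set (r := pre (length p + length q) y).
  assert (lr : length r = length p + length q) by apply length_pre.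
  assert (cr : in_cyl r y) by apply in_cyl_pre_self.
  apply (k (wcat r zeros)).
  - apply (in_cyl_long q y r); auto using in_cyl_wcat; lia.
  - apply h.
    + apply in_Q2_wcat, in_Q2_zeros.
    + apply (in_cyl_long p y r); auto using in_cyl_wcat; lia.
Qed.

(** Triviality of a germ in terms of fixed points in Q_2 only, which automorphisms of V will be seen
    to respect. The element [w] moves a whole neighbourhood of [x], and Q_2 is dense there. *)
Lemma triv_iff v x : isV v -> in_Q2 x ->
  triv v x <-> exists w, isV w /\ w x <> x /\
    forall z, in_Q2 z -> v z = z \/ w z = z.
Proof.
  intros hv qx. split.
  - intros (m & c & a). exists (swap_halves m). repeat split.
    + apply isV_swap_halves.
    + now apply swap_halves_in.
    + intros z _. destruct (classic (in_cyl m z)) as [i|i].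
      * left. apply in_cyl_ex in i. destruct i as [t ->]. apply a.
      * right. now apply swap_halves_out.
  - intros (w & hw & nx & h). destruct (moved_open w x hw nx) as (p & c & k).
    apply (open_triv v x p c). apply fix_dense; auto.
    intros y q d. destruct (h y q); auto. now apply k in d.
Qed.

Definition pow (n : nat) (v : cantor -> cantor) : cantor -> cantor :=
  fun x => Nat.iter n v x.

Lemma isV_pow n v : isV v -> isV (pow n v).
Proof.
  intros hv. induction n as [|n IH]; [apply isV_id|].
  apply (isV_comp v (pow n v)); auto.
Qed.

Lemma pow_fix n v x : v x = x -> pow n v x = x.
Proof.
  intros e. induction n as [|n IH]; auto. change (v (pow n v x) = x). now rewrite IH.
Qed.

Lemma slope_pow n v x s : isV v -> v x = x -> slope v x s ->
  slope (pow n v) x (Z.of_nat n * s).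
Proof.
  intros hv e h. induction n as [|n IH]; [apply slope_id|].
  replace (Z.of_nat (S n) * s)%Z with (Z.of_nat n * s + s)%Z by lia.
  apply (slope_comp v (pow n v)); auto using isV_pow. now rewrite pow_fix.
Qed.

(** [x] is an attracting fixed point of [v], expressed through the sets of
    points of Q_2 moved by elements of V. *)
Definition attract (v : cantor -> cantor) (x : cantor) : Prop :=
  exists w, isV w /\ w x <> x /\ forall w', isV w' -> w' x <> x ->
    exists n, forall y, in_Q2 y -> w y <> y -> w' (pow n v y) <> pow n v y.

(** Powers of [v] shrink the cone [m] into any neighbourhood of [x], so [swap_halves m] can serve as
    [w]. *)
Lemma slope_neg_attract v x s : isV v -> v x = x -> slope v x s -> (s < 0)%Z ->
  attract v x.
Proof.
  intros hv e (m & m' & c & a & ->) l.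
  assert (c' : in_cyl m' x) by (rewrite <- e; now apply in_cyl_img with m).
  destruct (in_cyl_both m m' x c c') as [r ->]; [lia|].
  rewrite length_app in l.
  assert (it : forall n, exists s, n <= length s /\ aff (pow n v) m (m ++ s)).
  { induction n as [|n [s [ls hs]]].
    - exists []. rewrite app_nil_r. split; auto. now intros z.
    - exists (r ++ s). split; [rewrite length_app; lia|]. intros z.
      change (v (pow n v (wcat m z)) = wcat (m ++ r ++ s) z).
      now rewrite hs, wcat_app, a, <- wcat_app, <- app_assoc. }
  exists (swap_halves m). split; [apply isV_swap_halves|].
  split; [now apply swap_halves_in|]. intros w' hw' ne.
  destruct (moved_open w' x hw' ne) as (p & d & k).
  exists (length p). intros y _ my. apply k.
  destruct (classic (in_cyl m y)) as [i|i].
  - destruct (it (length p)) as [s [ls hs]].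
    apply (in_cyl_long p x (m ++ s)); auto.
    + rewrite <- (pow_fix (length p) v x e). now apply in_cyl_img with m.
    + rewrite length_app. lia.
    + now apply in_cyl_img with m.
  - now apply swap_halves_out in i.
Qed.

(** With nonnegative slope the image of a small cone [M] at [x] contains [M], so every power of [v]
    takes some point of [M] into the half of [M] away from [x]. Take [w'] supported on the other
    half. *)
Lemma attract_slope_neg v x s : isV v -> v x = x -> slope v x s -> attract v x ->
  (s < 0)%Z.
Proof.
  intros hv e (m & m' & c & a & ->) (w & hw & nx & h).
  apply Z.nle_gt. intros l.
  destruct (moved_open w x hw nx) as (p & d & k).
  apply in_cyl_ex in c. destruct c as [z ex].
  set (r := pre (length p) z). set (M := m ++ r). set (M' := m' ++ r).
  assert (cr : in_cyl r z) by apply in_cyl_pre_self.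
  assert (aM : aff v M M') by now apply aff_app.
  assert (cM : in_cyl M x) by (rewrite ex; now apply in_cyl_app).
  assert (cM' : in_cyl M' x) by (rewrite <- e; now apply in_cyl_img with M).
  assert (lM : length M' <= length M /\ length p <= length M).
  { unfold M, M', r. rewrite !length_app, length_pre. lia. }
  destruct (in_cyl_both M' M x cM' cM) as [t et]; [lia|].
  assert (back : forall n q, in_Q2 q -> in_cyl M q ->
    exists y, in_Q2 y /\ in_cyl M y /\ pow n v y = q).
  { induction n as [|n IH]; intros q qq cq.
    - exists q. auto.
    - rewrite et in cq. apply in_cyl_appl in cq. apply in_cyl_ex in cq.
      destruct cq as [q' ->]. apply in_Q2_wcat in qq.
      destruct (IH (wcat M q')) as (y & qy & cy & ey).
      + now apply in_Q2_wcat.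
      + apply in_cyl_wcat.
      + exists y. repeat split; auto. change (v (pow n v y) = wcat M' q').
        now rewrite ey. }
  pose proof cM as cM2. apply in_cyl_ex in cM2. destruct cM2 as [x' ex'].
  set (b := x' 0).
  assert (cb : in_cyl (M ++ [b]) x).
  { rewrite ex'. apply in_cyl_app. intros i li. simpl in li.
    now replace i with 0 by lia. }
  destruct (h (swap_halves (M ++ [b]))) as [n hn].
  - apply isV_swap_halves.
  - now apply swap_halves_in.
  - destruct (back n (wcat (M ++ [negb b]) zeros)) as (y & qy & cy & ey).
    + apply in_Q2_wcat, in_Q2_zeros.
    + rewrite wcat_app. apply in_cyl_wcat.
    + apply (hn y); auto.
      * apply k. apply (in_cyl_long p x M); auto. lia.
      * rewrite ey. apply swap_halves_out. intros i.
        apply (disj_app M _ _ (disj_cons b [] []) _ i), in_cyl_wcat.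
Qed.

(** As [m.000...] equals [m0.000...], replacing [m] by [m0] fixes this point. *)
Lemma contracting_ex x : in_Q2 x -> exists v, isV v /\ v x = x /\ slope v x (-1).
Proof.
  intros q. apply in_Q2_word in q. destruct q as [m ->].
  assert (E : wcat (m ++ [false]) zeros = wcat m zeros).
  { rewrite wcat_app. f_equal. apply functional_extensionality.
    intros [|i]; reflexivity. }
  destruct (move m (m ++ [false]) zeros []) as (u & r & hu & cr & a & _); auto.
  exists u. repeat split; auto.
  - rewrite <- E at 2. rewrite (in_cyl_split r zeros cr), <- !wcat_app. apply a.
  - exists (m ++ r), ((m ++ [false]) ++ r). repeat split; auto.
    + now apply in_cyl_app.
    + rewrite !length_app. simpl. lia.
Qed.

(** * Automorphisms of V and point stabilisers *)

Section Automorphism.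
Variables psi psi' : (cantor -> cantor) -> (cantor -> cantor).
Hypothesis psi_V : forall v, isV v -> isV (psi v).
Hypothesis psi'_V : forall v, isV v -> isV (psi' v).
Hypothesis psiK : forall v, isV v -> psi' (psi v) = v.
Hypothesis psi'K : forall v, isV v -> psi (psi' v) = v.
Hypothesis psi_comp : forall v w, isV v -> isV w ->
  psi (fun x => v (w x)) = fun x => psi v (psi w x).

Lemma psi_id : psi (fun x => x) = fun x => x.
Proof.
  apply functional_extensionality. intros x.
  apply (isV_inj (psi (fun x => x))); auto using isV_id.
  now rewrite <- (equal_f (psi_comp (fun x => x) (fun x => x) isV_id isV_id) x).
Qed.

Lemma psi_inv v : isV v -> psi (Vinv v) = Vinv (psi v).
Proof.
  intros hv. apply functional_extensionality. intros x.
  symmetry. apply Vinv_eq; auto.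
  rewrite <- (equal_f (psi_comp v (Vinv v) hv (isV_inv v hv)) x).
  replace (fun x => v (Vinv v x)) with (fun x : cantor => x).
  - now rewrite psi_id.
  - apply functional_extensionality. intros y. symmetry. now apply VinvKr.
Qed.

Lemma psi'_comp v w : isV v -> isV w ->
  psi' (fun x => v (w x)) = fun x => psi' v (psi' w x).
Proof.
  intros hv hw. rewrite <- (psiK (fun x => psi' v (psi' w x)))
    by auto using isV_comp.
  f_equal. rewrite psi_comp, !psi'K; auto.
Qed.

Lemma stabiliser_to_stabiliser x : in_Q2 x ->
  (exists F, F <> [] /\ (forall f, In f F -> in_Q2 f) /\
     forall v, isV v -> triv v x -> forall f, In f F <-> In (psi v f) F) ->
  exists y, in_Q2 y /\ forall v, isV v -> (v x = x <-> psi v y = y).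
Proof.
  intros qx (F & nF & qF & hF).
  assert (sgA : Vsubgroup (fun v => forall f, In f F <-> In (psi v f) F)).
  { split.
    - intros v w hv hw a b f. rewrite psi_comp by auto. rewrite (b f). apply a.
    - intros v hv a f. rewrite psi_inv by auto. symmetry.
      rewrite (a (Vinv (psi v) f)), VinvKr by auto. reflexivity. }
  (* Otherwise all of V would preserve [F] through [psi], by [stabiliser_maximal]. *)
  assert (stabF : forall v, isV v -> (forall f, In f F <-> In (psi v f) F) -> v x = x).
  { intros v hv a. apply NNPP. intros ne.
    destruct F as [|f F']; [congruence|].
    destruct (V_moves_finite (f :: F') f) as (u & hu & nu).
    { apply qF. now left. }
    assert (K := stabiliser_maximal _ x v sgA qx
      (fun w hw t => hF w hw (t x (or_introl eq_refl))) hv a ne (psi' u) (psi'_V u hu) f).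
    cbv beta in K. rewrite psi'K in K by auto. apply nu, K. now left. }
  (* This is [psi (Stab x)], with core [F0] below. *)
  set (H := fun w => isV w /\ psi' w x = x).
  assert (psi'_inv : forall v, isV v -> psi' (Vinv v) = Vinv (psi' v)).
  { intros v hv. rewrite <- (psiK (Vinv (psi' v))) by auto using isV_inv.
    now rewrite psi_inv, psi'K by auto. }
  assert (sgH : Vsubgroup H).
  { split.
    - intros v w hv hw [_ a] [_ b]. split; auto using isV_comp.
      rewrite psi'_comp by auto. now rewrite b.
    - intros v hv [_ a]. split; auto using isV_inv.
      rewrite psi'_inv by auto. apply Vinv_eq; auto. }
  set (eqd := fun a b : cantor => excluded_middle_informative (a = b)).
  destruct (Vsubgroup_core H (nodup eqd F)) as (F0 & nd & q0 & tf & pres); auto.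
  { now intros v []. }
  { apply NoDup_nodup. }
  { intros f i. apply nodup_In in i. auto. }
  { intros w hw t. split; auto. apply stabF; auto. rewrite psi'K by auto.
    intros f. split; intros i.
    - rewrite triv_fix; auto. apply t. now apply nodup_In.
    - replace f with (w f); auto. apply (isV_inj w); auto.
      apply triv_fix, t. now apply nodup_In. }
  destruct F0 as [|y1 [|y2 F0]].
  - destruct (V_moves_finite [x] x qx) as (u & hu & nu).
    exfalso. apply nu. left.
    destruct (tf (psi u) (psi_V u hu)) as [_ e]; [intros f []|].
    rewrite psiK in e; auto.
  - exists y1. split; [apply q0; now left|].
    assert (D : forall v, isV v -> v x = x -> psi v y1 = y1).
    { intros v hv e. destruct (pres (psi v) y1) as [k|[]]; auto.
      - split; auto. now rewrite psiK.
      - now left. }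
    (* Conversely, if [psi v] fixed [y1] while [v] moved [x], the preimage of the stabiliser of [y1]
       would be all of V. *)
    intros v hv. split; auto. intros e. apply NNPP. intros ne.
    assert (sgB : Vsubgroup (fun v => psi v y1 = y1)).
    { split.
      - intros a b ha hb ea eb. rewrite psi_comp, eb by auto. auto.
      - intros a ha ea. rewrite psi_inv by auto. apply Vinv_eq; auto. }
    destruct (V_moves_finite [y1] y1) as (u & hu & nu); [apply q0; now left|].
    assert (K := stabiliser_maximal _ x v sgB qx
      (fun w hw t => D w hw (triv_fix w x (t x (or_introl eq_refl)))) hv e ne
      (psi' u) (psi'_V u hu)).
    cbv beta in K. rewrite psi'K in K by auto. apply nu. now left.
  (* Both [u] and [w] lie outside [H], so some [s] fixing [x] puts [w^-1 (psi s) u] into [H]. This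
     element preserves [F1]; evaluated at [y2], which [u] fixes, it yields a point of [F1] that [w]
     keeps in [F1]. *)
  - exfalso. set (F1 := y1 :: y2 :: F0) in *.
    destruct (fresh_Q2 F1) as [t [qt ht]].
    assert (n12 : y1 <> y2).
    { intros e. inversion nd as [|? ? k _]. apply k. rewrite e. now left. }
    destruct (move_point y1 t [y2]) as (u & hu & ut & tu); auto.
    { apply q0. now left. }
    { intros [e|[]]; congruence. }
    { intros [e|[]]. apply ht. rewrite <- e. right. now left. }
    assert (u2 : u y2 = y2) by (apply triv_fix, tu; now left).
    destruct (move_off F1 F1 q0) as (w & hw & nw).
    assert (nHu : psi' u x <> x).
    { intros e. apply ht. rewrite <- ut. apply pres; [now split|now left]. }
    assert (nHw : psi' w x <> x).
    { intros e. apply (nw y1); [now left|]. apply pres; [now split|now left]. }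
    destruct (move_point (psi' u x) (psi' w x) [x]) as (s & hs & es & ts);
      auto using in_Q2_V.
    { intros [e|[]]; congruence. }
    { intros [e|[]]; congruence. }
    assert (Hs : H (psi s)).
    { split; auto. rewrite psiK by auto. apply triv_fix, ts. now left. }
    assert (Hk : H (fun y => Vinv w (psi s (u y)))).
    { assert (isV (fun y => psi s (u y))) by (apply isV_comp; auto).
      split.
      - apply (isV_comp (Vinv w) (fun y => psi s (u y))); auto using isV_inv.
      - rewrite (psi'_comp (Vinv w) (fun y => psi s (u y))) by auto using isV_inv.
        rewrite (psi'_comp (psi s) u), psiK, es, psi'_inv by auto. apply VinvK; auto. }
    assert (i2 : In y2 F1) by (right; now left).
    apply (nw (Vinv w (psi s (u y2)))).
    + now apply (pres _ y2 Hk).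
    + rewrite VinvKr, u2 by auto. auto.
Qed.
End Automorphism.

(** The inverse is part of the data, so that every statement can be applied in the other direction
    by [Vaut_sym]. *)
Record Vaut (psi psi' : (cantor -> cantor) -> (cantor -> cantor)) : Prop := {
  va_V : forall v, isV v -> isV (psi v);
  va_V' : forall v, isV v -> isV (psi' v);
  va_K : forall v, isV v -> psi' (psi v) = v;
  va_K' : forall v, isV v -> psi (psi' v) = v;
  va_comp : forall v w, isV v -> isV w ->
    psi (fun x => v (w x)) = fun x => psi v (psi w x)
}.

Lemma Vaut_sym psi psi' : Vaut psi psi' -> Vaut psi' psi.
Proof.
  intros [a b c d e]. constructor; auto. apply (psi'_comp psi psi'); auto.
Qed.

Definition matched (psi : (cantor -> cantor) -> (cantor -> cantor)) (x y : cantor) :=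
  in_Q2 x /\ in_Q2 y /\ forall v, isV v -> (v x = x <-> psi v y = y).

Lemma matched_sym psi psi' x y : Vaut psi psi' -> matched psi x y -> matched psi' y x.
Proof.
  intros A (qx & qy & h). split; [|split]; auto. intros v hv.
  rewrite (h (psi' v) (va_V' _ _ A v hv)), (va_K' _ _ A v hv). reflexivity.
Qed.

Section Matched.
Variables psi psi' : (cantor -> cantor) -> (cantor -> cantor).
Hypothesis A : Vaut psi psi'.
Variables x y : cantor.
Hypothesis M : matched psi x y.

Lemma Vaut_inv v : isV v -> psi (Vinv v) = Vinv (psi v).
Proof. destruct A. now apply psi_inv. Qed.

Lemma Vaut_pow n v : isV v -> psi (pow n v) = pow n (psi v).
Proof.
  intros hv. induction n as [|n IH].
  - destruct A. now apply psi_id.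
  - change (psi (fun x => v (pow n v x)) = fun x => psi v (pow n (psi v) x)).
    rewrite (va_comp _ _ A), IH; auto using isV_pow.
Qed.

(** Conjugation by [v] spreads the correspondence of fixed points from [x] and [y] to their orbits,
    which are all of Q_2. *)
Lemma matched_fix v w : isV v -> isV w ->
  (w (v x) = v x <-> psi w (psi v y) = psi v y).
Proof.
  intros hv hw. destruct M as (qx & qy & h).
  assert (hu : isV (fun z => w (v z))) by now apply isV_comp.
  assert (K := h (fun z => Vinv v (w (v z)))
    (isV_comp (Vinv v) (fun z => w (v z)) (isV_inv v hv) hu)).
  rewrite (va_comp _ _ A (Vinv v) (fun z => w (v z))) in K by auto using isV_inv.
  rewrite (va_comp _ _ A w v), Vaut_inv in K by auto.
  assert (B : forall (u : cantor -> cantor) z z', isV u -> (Vinv u z = z' <-> z = u z')).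
  { intros u z z' hu'. split.
    - intros <-. now rewrite VinvKr.
    - intros ->. now apply VinvK. }
  rewrite !B in K; auto. now apply (va_V _ _ A).
Qed.

Lemma matched_orbit z : in_Q2 z -> exists v, isV v /\ z = v x.
Proof.
  intros q. destruct M as (qx & _ & _).
  destruct (move_point x z []) as (u & hu & e & _); eauto.
Qed.
End Matched.

Section MatchedGerms.
Variables psi psi' : (cantor -> cantor) -> (cantor -> cantor).
Hypothesis A : Vaut psi psi'.
Variables x y : cantor.
Hypothesis M : matched psi x y.

Lemma matched_orbit_image z : in_Q2 z -> exists v, isV v /\ z = psi v y.
Proof.
  intros q. destruct (matched_orbit psi' y x) with z as (u & hu & ->); auto.
  - apply (matched_sym psi psi'); auto.
  - exists (psi' u). split; [now apply (va_V' _ _ A)|]. now rewrite (va_K' _ _ A).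
Qed.

Lemma matched_triv v : isV v -> triv v x -> triv (psi v) y.
Proof.
  intros hv t. destruct M as (qx & qy & h).
  apply triv_iff in t; auto. destruct t as (w & hw & nx & k).
  apply triv_iff; auto; [now apply (va_V _ _ A)|].
  exists (psi w). split; [now apply (va_V _ _ A)|]. split.
  - rewrite <- (h w hw). auto.
  - intros z q. destruct (matched_orbit_image z q) as (u & hu & ->).
    rewrite <- !(matched_fix psi psi' A x y M) by auto.
    apply k. now apply in_Q2_V.
Qed.

Lemma matched_attract v : isV v -> attract v x -> attract (psi v) y.
Proof.
  intros hv (w & hw & nx & k). pose proof M as (qx & qy & h).
  exists (psi w). split; [now apply (va_V _ _ A)|]. split.
  { rewrite <- (h w hw). auto. }
  intros w' hw' ny.
  assert (hp := va_V' _ _ A w' hw').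
  destruct (k (psi' w')) as [n hn]; auto.
  { rewrite (h _ hp), (va_K' _ _ A); auto. }
  exists n. intros z q.
  destruct (matched_orbit_image z q) as (u & hu & ->).
  rewrite <- (matched_fix psi psi' A x y M) by auto.
  intros mz. rewrite <- (Vaut_pow psi psi' A n v hv).
  assert (hc : isV (fun a => pow n v (u a))) by (apply isV_comp; auto using isV_pow).
  assert (E : psi (pow n v) (psi u y) = psi (fun a => pow n v (u a)) y)
    by (now rewrite (va_comp _ _ A (pow n v) u) by auto using isV_pow).
  rewrite E, <- (va_K' _ _ A w' hw'), <- (matched_fix psi psi' A x y M) by auto.
  apply hn; auto. now apply in_Q2_V.
Qed.
End MatchedGerms.

(** The slope character of the stabiliser of [x] is determined up to sign by the
    subgroup of trivial germs, and its sign by the attracting fixed points. *)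
Lemma matched_slope psi psi' x y v : Vaut psi psi' -> matched psi x y -> isV v ->
  v x = x -> slope v x (-1) -> slope (psi v) y (-1).
Proof.
  intros A M hv e s. pose proof M as (qx & qy & h).
  assert (A' := Vaut_sym _ _ A). assert (M' := matched_sym _ _ _ _ A M).
  assert (hpv := va_V _ _ A v hv).
  assert (ey : psi v y = y) by now apply h.
  destruct (slope_ex (psi v) y hpv) as [t ht].
  assert (t0 : (t < 0)%Z).
  { apply (attract_slope_neg (psi v) y); auto.
    apply (matched_attract psi psi' A x y M); auto.
    apply (slope_neg_attract v x (-1)); auto; lia. }
  destruct (contracting_ex y qy) as (b & hb & eb & sb).
  set (a := psi' b). assert (ha : isV a) by now apply (va_V' _ _ A).
  assert (pa : psi a = b) by now apply (va_K' _ _ A).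
  assert (ea : a x = x) by (apply h; auto; now rewrite pa).
  destruct (slope_ex a x ha) as [j hj].
  assert (j0 : (j < 0)%Z).
  { apply (attract_slope_neg a x); auto.
    apply (matched_attract psi' psi A' y x M'); auto.
    apply (slope_neg_attract b y (-1)); auto; lia. }
  (* With this exponent [pow k v] and [a] have the same slope at [x], hence the same germ. *)
  set (k := Z.to_nat (- j)).
  assert (hk := isV_pow k v hv).
  assert (T : triv (fun z => Vinv (pow k v) (a z)) x).
  { apply slope_triv.
    - rewrite ea. apply Vinv_eq; auto. now apply pow_fix.
    - replace 0%Z with (j + - (Z.of_nat k * -1))%Z by lia.
      apply (slope_comp (Vinv (pow k v)) a); auto using isV_inv.
      rewrite ea. rewrite <- (pow_fix k v x e) at 1.
      apply slope_inv; auto. now apply slope_pow. }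
  apply (matched_triv psi psi' A x y M) in T.
  2: { apply (isV_comp (Vinv (pow k v)) a); auto using isV_inv. }
  rewrite (va_comp _ _ A (Vinv (pow k v)) a) in T by auto using isV_inv.
  rewrite (Vaut_inv psi psi' A), (Vaut_pow psi psi' A), pa in T by auto.
  apply triv_slope in T.
  assert (S2 : slope (fun z => Vinv (pow k (psi v)) (b z)) y (-1 + - (Z.of_nat k * t))).
  { apply (slope_comp (Vinv (pow k (psi v))) b); auto using isV_inv, isV_pow.
    rewrite eb. rewrite <- (pow_fix k (psi v) y ey) at 1.
    apply slope_inv; auto using isV_pow. now apply slope_pow. }
  (* Comparison gives [k * t = -1] with [t < 0], whence [t = -1]. *)
  assert (E := slope_fun _ _ _ _ T S2).
  replace (-1)%Z with t; auto. nia.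
Qed.

(** * Isomorphisms of semidirect products *)

Notation idc := (fun x : cantor => x).
Notation onef := (fun _ : cantor => gone).

Section SemidirectProduct.
Variables (G : Group) (al : Aut G).
Implicit Types (a b : cantor -> G) (v w : cantor -> cantor).

Lemma vact_img v a x : isV v ->
  vact al v a (v x) = autpow al (log2_slope v x) (a x).
Proof. intros h. unfold vact. now rewrite VinvK. Qed.

Lemma vact_id a : vact al idc a = a.
Proof.
  apply functional_extensionality. intros x.
  rewrite (vact_img idc a x isV_id). now rewrite log2_slope_id.
Qed.

Lemma vact_one v : vact al v onef = onef.
Proof. apply functional_extensionality. intros x. apply autpow1. Qed.

Lemma fin_supp_one : @fin_supp_Q2 G onef.
Proof. exists []. now intros x h. Qed.

Lemma fin_supp_mul a b : fin_supp_Q2 a -> fin_supp_Q2 b ->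
  @fin_supp_Q2 G (fun x => gmul (a x) (b x)).
Proof.
  intros [l h] [l' h']. exists (l ++ l'). intros x n. rewrite in_app_iff.
  destruct (classic (a x = gone)) as [e|e].
  - rewrite e, gmul1l in n. apply h' in n. tauto.
  - apply h in e. tauto.
Qed.

Lemma fin_supp_inv a : fin_supp_Q2 a -> @fin_supp_Q2 G (fun x => ginv (a x)).
Proof.
  intros [l h]. exists l. intros x n. apply h. intros e. apply n.
  now rewrite e, ginv1.
Qed.

Lemma fin_supp_vact v a : isV v -> fin_supp_Q2 a -> fin_supp_Q2 (vact al v a).
Proof.
  intros hv [l h]. exists (map v l). intros x n.
  destruct (isV_surj v x hv) as [y <-]. rewrite vact_img in n by auto.
  destruct (h y) as [q i].
  - intros e. apply n. rewrite e. apply autpow1.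
  - split; [now apply in_Q2_V|now apply in_map].
Qed.

Lemma inSD_mul g1 g2 : inSD g1 -> inSD g2 -> inSD (sdmul al g1 g2).
Proof.
  intros [a b] [c d]. split.
  - apply fin_supp_mul; auto. now apply fin_supp_vact.
  - now apply (isV_comp (snd g1) (snd g2)).
Qed.

Definition delta (x : cantor) (g : G) : cantor -> G :=
  fun z => if excluded_middle_informative (z = x) then g else gone.

Lemma delta_eq x g : delta x g x = g.
Proof. unfold delta. destruct (excluded_middle_informative _); tauto. Qed.

Lemma delta_ne x g z : z <> x -> delta x g z = gone.
Proof. intros n. unfold delta. destruct (excluded_middle_informative _); tauto. Qed.

Lemma fin_supp_delta x g : in_Q2 x -> fin_supp_Q2 (delta x g).
Proof.
  intros q. exists [x]. intros z n. destruct (classic (z = x)) as [->|e].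
  - split; auto. now left.
  - now rewrite delta_ne in n.
Qed.

Lemma delta_mul x g h :
  delta x (gmul g h) = fun z => gmul (delta x g z) (delta x h z).
Proof.
  apply functional_extensionality. intros z. unfold delta.
  destruct (excluded_middle_informative _); auto. now rewrite gmul1l.
Qed.

(** The stabiliser of [x] acts on the factor at [x] through powers of [al]; this is how [al] is
    recovered from the group. *)
Lemma vact_delta v x g s : isV v -> v x = x -> slope v x s ->
  vact al v (delta x g) = delta x (autpow al s g).
Proof.
  intros hv e hs. apply functional_extensionality. intros z.
  destruct (isV_surj v z hv) as [y <-]. rewrite vact_img by auto.
  destruct (classic (y = x)) as [->|n].
  - now rewrite e, !delta_eq, (log2_slope_eq v x s).
  - rewrite !delta_ne; auto using autpow1.
    intros k. apply n. apply (isV_inj v); auto. congruence.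
Qed.

Lemma sdmul_KK a b :
  sdmul al (a, idc) (b, idc) = ((fun x => gmul (a x) (b x)), idc).
Proof. unfold sdmul. simpl. now rewrite vact_id. Qed.

Lemma sdmul_VV v w : sdmul al (onef, v) (onef, w) = (onef, fun x => v (w x)).
Proof.
  unfold sdmul. simpl. rewrite vact_one. f_equal.
  apply functional_extensionality. intros x. apply gmul1l.
Qed.

Lemma sdmul_KV a v : sdmul al (a, idc) (onef, v) = (a, v).
Proof.
  unfold sdmul. simpl. rewrite vact_id. f_equal.
  apply functional_extensionality. intros x. apply gmul1r.
Qed.

(** Normality of the direct sum, written without inverses in the semidirect product. *)
Lemma sdmul_gK b w a :
  sdmul al (b, w) (a, idc) =
  sdmul al ((fun x => gmul (gmul (b x) (vact al w a x)) (ginv (b x))), idc) (b, w).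
Proof.
  unfold sdmul. simpl. rewrite vact_id. f_equal.
  apply functional_extensionality. intros x. now rewrite gmulKV.
Qed.

Lemma sdmul_VK v a :
  sdmul al (onef, v) (a, idc) = sdmul al (vact al v a, idc) (onef, v).
Proof.
  rewrite sdmul_gK. do 2 f_equal. apply functional_extensionality. intros x.
  now rewrite gmul1l, ginv1, gmul1r.
Qed.

Lemma inSD_K a : fin_supp_Q2 a -> @inSD G (a, idc).
Proof. intros h. split; auto. apply isV_id. Qed.

Lemma inSD_V v : isV v -> @inSD G (onef, v).
Proof. intros h. split; auto. apply fin_supp_one. Qed.
End SemidirectProduct.
Arguments delta {G}.

Record SDiso {G H : Group} (al : Aut G) (be : Aut H)
  (t : raw G -> raw H) (t' : raw H -> raw G) : Prop := {
  sd_in : forall g, inSD g -> inSD (t g);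
  sd_in' : forall h, inSD h -> inSD (t' h);
  sd_K : forall g, inSD g -> t' (t g) = g;
  sd_K' : forall h, inSD h -> t (t' h) = h;
  sd_mul : forall g1 g2, inSD g1 -> inSD g2 ->
    t (sdmul al g1 g2) = sdmul be (t g1) (t g2)
}.

Lemma SDiso_sym {G H : Group} (al : Aut G) (be : Aut H) t t' :
  SDiso al be t t' -> SDiso be al t' t.
Proof.
  intros [a b c d e]. constructor; auto. intros h1 h2 i1 i2.
  rewrite <- (c (sdmul al (t' h1) (t' h2))) by auto using inSD_mul.
  now rewrite e, !d by auto.
Qed.

Lemma SDiso_ex {G H : Group} (al : Aut G) (be : Aut H) :
  sd_isomorphic al be -> exists t t', SDiso al be t t'.
Proof.
  intros (t & hin & hinj & hsurj & hmul).
  set (t' := fun h => epsilon (inhabits (onef, idc)) (fun g => inSD g /\ t g = h)).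
  assert (E : forall h, inSD h -> inSD (t' h) /\ t (t' h) = h).
  { intros h i. apply (epsilon_spec (inhabits (onef, idc))
      (fun g => inSD g /\ t g = h)). auto. }
  exists t, t'. constructor; auto.
  - apply E.
  - intros g i. apply hinj; auto; now apply E, hin.
  - apply E.
Qed.

(** * Invariance of the direct sum and the induced automorphism of V *)

Section Quotient.
Variables (G H : Group) (al : Aut G) (be : Aut H).
Variables (t : raw G -> raw H) (t' : raw H -> raw G).
Hypothesis I : SDiso al be t t'.

Let snd_mul g1 g2 : inSD g1 -> inSD g2 ->
  snd (t (sdmul al g1 g2)) = fun x => snd (t g1) (snd (t g2) x).
Proof. intros i1 i2. now rewrite (sd_mul _ _ _ _ I). Qed.

Let sndV g : inSD g -> isV (snd (t g)).
Proof. intros i. now apply (sd_in _ _ _ _ I). Qed.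

Lemma SDiso_one : t (onef, idc) = (onef, idc).
Proof.
  assert (i : inSD (G := G) (onef, idc)) by apply inSD_V, isV_id.
  assert (E := sd_mul _ _ _ _ I _ _ i i). rewrite sdmul_VV in E.
  assert (e2 : snd (t (onef, idc)) = idc).
  { apply functional_extensionality. intros x.
    apply (isV_inj (snd (t (onef, idc)))); auto.
    exact (equal_f (eq_sym (f_equal snd E)) x). }
  destruct (t (onef, idc)) as [a v]. simpl in e2. subst v.
  rewrite sdmul_KK in E. f_equal. apply functional_extensionality. intros x.
  apply gidem. injection E as E. exact (equal_f (eq_sym E) x).
Qed.

Let N n := exists a, @fin_supp_Q2 G a /\ n = snd (t (a, idc)).

Lemma SDiso_snd_K a : fin_supp_Q2 a -> snd (t (a, idc)) = idc.
Proof.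
  intros ha. apply functional_extensionality. intros x.
  apply (commuting_normal_trivial N); [..|exists a; auto].
  - intros n (b & hb & ->). auto using inSD_K.
  - intros n n' (b & hb & ->) (b' & hb' & ->).
    exists (fun x => gmul (b x) (b' x)). split; [now apply fin_supp_mul|].
    rewrite <- (sdmul_KK G al), snd_mul; auto using inSD_K.
  - intros n (b & hb & ->). assert (hi := fin_supp_inv _ _ hb).
    exists (fun x => ginv (b x)). split; auto.
    apply functional_extensionality. intros z. apply Vinv_eq; auto using inSD_K.
    assert (E := snd_mul (b, idc) ((fun x => ginv (b x)), idc)
      (inSD_K _ _ hb) (inSD_K _ _ hi)).
    rewrite <- (equal_f E z), sdmul_KK.
    replace (fun x => gmul (b x) (ginv (b x))) with (fun _ : cantor => @gone G).
    + now rewrite SDiso_one.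
    + apply functional_extensionality. intros y. now rewrite gmulVr.
  - intros n g (b & hb & ->) hg.
    (* To conjugate by [g], lift it through the inverse isomorphism to [(c, w)]. *)
    assert (ig := inSD_V H g hg). assert (is := sd_in' _ _ _ _ I _ ig).
    assert (es := sd_K' _ _ _ _ I _ ig).
    destruct (t' (onef, g)) as [c w]. destruct is as [hc hw]. simpl in hc, hw.
    set (b' := fun x => gmul (gmul (c x) (vact al w b x)) (ginv (c x))).
    assert (hb' : fin_supp_Q2 b').
    { apply fin_supp_mul; [|now apply fin_supp_inv].
      apply fin_supp_mul; auto. now apply fin_supp_vact. }
    exists b'. split; auto.
    apply functional_extensionality. intros z.
    assert (icw : inSD (c, w)) by now split.
    assert (E := f_equal snd (f_equal t (sdmul_gK G al c w b))).
    fold b' in E. rewrite !snd_mul, es in E by auto using inSD_K. simpl in E.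
    destruct (isV_surj g z hg) as [y <-]. rewrite VinvK by auto.
    exact (equal_f E y).
  - intros n1 n2 n3 n' (a1 & h1 & e1) (a2 & h2 & e2) (a3 & h3 & e3) (a' & h' & ->).
    destruct h1 as [l1 k1], h2 as [l2 k2], h3 as [l3 k3]. pose proof h' as [l' k'].
    (* The exact support of [a']: the list [l'] may contain other points, even outside Q_2, to which
       [move_off] would not apply. *)
    set (E := filter (fun z => if excluded_middle_informative (a' z = gone)
                               then false else true) l').
    assert (hE : forall z, a' z <> gone <-> In z E).
    { intros z. unfold E. rewrite filter_In.
      destruct (excluded_middle_informative _) as [e|e]; split; intros k.
      - contradiction.
      - destruct k. discriminate.
      - split; auto. now apply k'.
      - auto. }
    destruct (move_off E (l1 ++ l2 ++ l3)) as (w & hw & off).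
    { intros z i. apply hE in i. now apply k'. }
    set (b := vact al w a').
    assert (hb : fin_supp_Q2 b) by now apply fin_supp_vact.
    assert (ib := inSD_K _ _ hb). assert (i' := inSD_K _ _ h').
    assert (iw := inSD_V G w hw).
    exists (snd (t (onef, w))). split; auto.
    assert (cj : forall z, snd (t (onef, w)) (snd (t (a', idc))
               (Vinv (snd (t (onef, w))) z)) = snd (t (b, idc)) z).
    { intros z. destruct (isV_surj (snd (t (onef, w))) z (sndV _ iw)) as [y <-].
      rewrite VinvK by auto.
      assert (K := f_equal snd (f_equal t (sdmul_VK G al w a'))).
      rewrite !snd_mul in K by auto. exact (equal_f K y). }
    assert (off' : forall z, In z (l1 ++ l2 ++ l3) -> b z = gone).
    { intros z i. apply NNPP. intros k. destruct (isV_surj w z hw) as [y <-].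
      unfold b in k. rewrite vact_img in k by auto.
      apply (off y); auto. apply hE. intros e. apply k. rewrite e. apply autpow1. }
    assert (key : forall c, fin_supp_Q2 c ->
      (forall z, c z <> gone -> In z (l1 ++ l2 ++ l3)) ->
      forall z, snd (t (b, idc)) (snd (t (c, idc)) z) =
                snd (t (c, idc)) (snd (t (b, idc)) z)).
    { intros c hc hl z. assert (ic := inSD_K _ _ hc).
      assert (K : sdmul al (b, idc) (c, idc) = sdmul al (c, idc) (b, idc)).
      { rewrite !sdmul_KK. f_equal. apply functional_extensionality. intros y.
        destruct (classic (c y = gone)) as [e|e].
        - now rewrite e, gmul1l, gmul1r.
        - now rewrite (off' y), gmul1l, gmul1r by auto. }
      apply (f_equal t), (f_equal snd) in K. rewrite !snd_mul in K by auto.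
      exact (equal_f K z). }
    intros n hn z. rewrite !cj.
    destruct hn as [-> | [-> | ->]]; [rewrite e1|rewrite e2|rewrite e3]; apply key;
      (eexists; eassumption) || (intros y ne; rewrite !in_app_iff;
        (apply k1 in ne || apply k2 in ne || apply k3 in ne); tauto).
Qed.

Definition quot (v : cantor -> cantor) : cantor -> cantor := snd (t (onef, v)).

Lemma SDiso_snd a v : fin_supp_Q2 a -> isV v -> snd (t (a, v)) = quot v.
Proof.
  intros ha hv. rewrite <- (sdmul_KV G al a v), snd_mul by auto using inSD_K, inSD_V.
  now rewrite SDiso_snd_K.
Qed.

Lemma SDiso_restrict_K a : fin_supp_Q2 a -> t (a, idc) = (fst (t (a, idc)), idc).
Proof.
  intros ha. rewrite <- (SDiso_snd_K a ha) at 3. now destruct (t (a, idc)).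
Qed.

Lemma SDiso_fin_supp g : inSD g -> fin_supp_Q2 (fst (t g)).
Proof. intros i. now apply (sd_in _ _ _ _ I). Qed.

Lemma quot_comp v w : isV v -> isV w ->
  quot (fun x => v (w x)) = fun x => quot v (quot w x).
Proof.
  intros hv hw. unfold quot. rewrite <- (sdmul_VV G al), snd_mul; auto using inSD_V.
Qed.

Lemma quot_V v : isV v -> isV (quot v).
Proof. intros h. apply sndV. now apply inSD_V. Qed.

(** The image of the relation [sdmul_VK], read in the first component. *)
Lemma SDiso_conj v a x : isV v -> fin_supp_Q2 a ->
  gmul (fst (t (onef, v)) x) (vact be (quot v) (fst (t (a, idc))) x) =
  gmul (fst (t (vact al v a, idc)) x) (fst (t (onef, v)) x).
Proof.
  intros hv ha. assert (hb := fin_supp_vact _ al v a hv ha).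
  assert (E := f_equal t (sdmul_VK G al v a)).
  rewrite !(sd_mul _ _ _ _ I) in E by auto using inSD_K, inSD_V.
  rewrite (SDiso_restrict_K _ ha), (SDiso_restrict_K _ hb) in E.
  apply (f_equal fst) in E. unfold sdmul in E. cbn [fst snd] in E.
  rewrite vact_id in E. exact (equal_f E x).
Qed.

(** As [v] fixes [delta x g], the images of the two commute; the values at [z] and [quot v z] then
    differ by a power of [be] and a conjugation. *)
Lemma support_invariant v x g z : isV v -> in_Q2 x -> triv v x ->
  (fst (t (delta x g, idc)) z = gone <->
   fst (t (delta x g, idc)) (quot v z) = gone).
Proof.
  intros hv q tv.
  assert (E := SDiso_conj v (delta x g) (quot v z) hv (fin_supp_delta _ x g q)).
  rewrite (vact_delta _ al v x g 0) in E; auto using triv_fix, triv_slope.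
  rewrite vact_img in E by now apply quot_V. simpl autpow in E.
  split; intros e.
  - rewrite e, autpow1, gmul1r in E.
    apply (gmul_injr H (fst (t (onef, v)) (quot v z))). now rewrite gmul1l.
  - rewrite e, gmul1l in E. apply autpow_eq1 with be (log2_slope (quot v) z).
    apply (gmul_injl H (fst (t (onef, v)) (quot v z))). now rewrite gmul1r.
Qed.
End Quotient.

Lemma quot_Vaut {G H : Group} (al : Aut G) (be : Aut H) t t' :
  SDiso al be t t' -> Vaut (quot G H t) (quot H G t').
Proof.
  intros I. assert (I' := SDiso_sym al be t t' I).
  assert (W : forall (G H : Group) (al : Aut G) (be : Aut H) t t',
    SDiso al be t t' -> forall v, isV v -> quot H G t' (quot G H t v) = v).
  { clear. intros G H al be t t' I v hv. assert (iv := inSD_V G v hv).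
    assert (I' := SDiso_sym al be t t' I).
    rewrite <- (SDiso_snd _ _ be al t' t I' (fst (t (onef, v))));
      [|now apply (SDiso_fin_supp _ _ al be t t')|now apply (quot_V _ _ al be t t')].
    unfold quot. rewrite <- surjective_pairing, (sd_K _ _ _ _ I) by auto.
    reflexivity. }
  constructor.
  - exact (quot_V _ _ al be t t' I).
  - exact (quot_V _ _ be al t' t I').
  - exact (W _ _ al be t t' I).
  - exact (W _ _ be al t' t I').
  - exact (quot_comp _ _ al be t t' I).
Qed.

Lemma SDiso_inj {G H : Group} (al : Aut G) (be : Aut H) t t' g1 g2 :
  SDiso al be t t' -> inSD g1 -> inSD g2 -> t g1 = t g2 -> g1 = g2.
Proof.
  intros I i1 i2 e. now rewrite <- (sd_K _ _ _ _ I g1), e, (sd_K _ _ _ _ I g2).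
Qed.

Lemma delta_one_inj {G : Group} x (g : G) : delta x g = onef -> g = gone.
Proof. intros e. rewrite <- (delta_eq G x g). now rewrite e. Qed.

(** The finite set is the support of the image of [delta x g], nonempty because [g] is
    nontrivial. *)
Lemma SDiso_matched {G H : Group} (al : Aut G) (be : Aut H) t t' x (g : G) :
  SDiso al be t t' -> in_Q2 x -> g <> gone ->
  exists y, matched (quot G H t) x y.
Proof.
  intros I q ng. assert (A := quot_Vaut al be t t' I).
  assert (fd := fin_supp_delta _ x g q).
  set (b := fst (t (delta x g, idc))).
  assert (hb : fin_supp_Q2 b)
    by (apply (SDiso_fin_supp _ _ al be t t' I); now apply inSD_K).
  destruct hb as [l hl].
  set (F := filter (fun z => if excluded_middle_informative (b z = gone)
                             then false else true) l).
  assert (hF : forall z, In z F <-> b z <> gone).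
  { intros z. unfold F. rewrite filter_In.
    destruct (excluded_middle_informative _) as [e|e]; split; intros k; auto.
    - destruct k. discriminate.
    - contradiction.
    - split; auto. now apply hl. }
  destruct (stabiliser_to_stabiliser (quot G H t) (quot H G t')
    (va_V _ _ A) (va_V' _ _ A) (va_K _ _ A) (va_K' _ _ A) (va_comp _ _ A) x q)
    as (y & qy & hy).
  - exists F. split; [|split].
    + intros e. apply ng, (delta_one_inj x).
      assert (E : (delta x g, idc) = (onef, idc)).
      { apply (SDiso_inj al be t t'); auto using inSD_K, fin_supp_one.
        rewrite (SDiso_one _ _ al be t t' I), (SDiso_restrict_K _ _ al be t t' I) by auto.
        f_equal. apply functional_extensionality. intros z. fold b.
        apply NNPP. intros k. apply hF in k. now rewrite e in k. }
      now injection E.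
    + intros f i. apply hF, hl in i. tauto.
    + intros v hv tv f. rewrite !hF. unfold b.
      now rewrite (support_invariant _ _ al be t t' I v x g f hv q tv).
  - exists y. now split.
Qed.

(** A second support point [z] could be moved out of the support by an element trivial near [y],
    against [support_invariant]. *)
Lemma SDiso_delta {G H : Group} (al : Aut G) (be : Aut H) t t' x y (g : G) :
  SDiso al be t t' -> matched (quot G H t) x y ->
  t (delta x g, idc) = (delta y (fst (t (delta x g, idc)) y), idc).
Proof.
  intros I M. pose proof M as (qx & qy & _).
  assert (A := quot_Vaut al be t t' I). assert (M' := matched_sym _ _ _ _ A M).
  assert (fd := fin_supp_delta _ x g qx).
  rewrite (SDiso_restrict_K _ _ al be t t' I _ fd) at 1. f_equal.
  set (b := fst (t (delta x g, idc))).
  apply functional_extensionality. intros z.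
  destruct (classic (z = y)) as [->|ne]; [now rewrite delta_eq|].
  rewrite delta_ne by auto. apply NNPP. intros nz.
  assert (hb : fin_supp_Q2 b)
    by (apply (SDiso_fin_supp _ _ al be t t' I); now apply inSD_K).
  destruct hb as [l hl].
  destruct (fresh_Q2 (y :: l)) as [s [qs ns]].
  destruct (move_point z s [y]) as (u & hu & us & tu); auto.
  - now apply hl.
  - intros [e|[]]. congruence.
  - intros [e|[]]. apply ns. now left.
  - assert (tw : triv (quot H G t' u) x).
    { apply (matched_triv _ _ (Vaut_sym _ _ A) y x M'); auto. apply tu. now left. }
    assert (hw := va_V' _ _ A u hu).
    apply nz, (support_invariant _ _ al be t t' I _ x g z hw qx tw).
    rewrite (va_K' _ _ A) by auto. fold b. rewrite us.
    apply NNPP. intros k. apply hl in k. apply ns. now right.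
Qed.

Lemma isomorphic_twisted_conjugate {Ga Gt : Group} (al : Aut Ga) (alt : Aut Gt) :
  sd_isomorphic al alt ->
  exists (be : Ga -> Gt) (h : Gt),
    group_iso be /\
    forall g : Ga, aut_fun alt (be g) = gmul (gmul h (be (aut_fun al g))) (ginv h).
Proof.
  intros J. destruct (SDiso_ex al alt J) as (t & t' & I). clear J.
  assert (I' := SDiso_sym al alt t t' I).
  set (x := zeros). assert (qx : in_Q2 x) by apply in_Q2_zeros.
  destruct (classic (exists g : Ga, g <> gone)) as [[g0 ng]|triv0].
  (* For trivial [Ga] no nontrivial [g] is available to locate [y], but then [Gt] is trivial as
     well. *)
  2: {
    assert (T : forall g : Ga, g = gone).
    { intros g. apply NNPP. intros k. eauto. }
    assert (T' : forall h : Gt, h = gone).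
    { intros h. apply (delta_one_inj x).
      assert (fd := fin_supp_delta _ x h qx).
      assert (E : (delta x h, idc) = (onef, idc)).
      { apply (SDiso_inj alt al t' t); auto using inSD_K, fin_supp_one.
        rewrite (SDiso_one _ _ alt al t' t I'),
          (SDiso_restrict_K _ _ alt al t' t I') by auto.
        f_equal. apply functional_extensionality. intros z. apply T. }
      now injection E. }
    exists (fun _ => gone), gone. split.
    - split; [|split].
      + intros. now rewrite gmul1l.
      + intros g g' _. now rewrite (T g), (T g').
      + intros h. exists gone. now rewrite (T' h).
    - intros g. rewrite (T' (aut_fun _ _)). symmetry. apply T'. }
  destruct (SDiso_matched al alt t t' x g0 I qx ng) as [y M].
  assert (A := quot_Vaut al alt t t' I). assert (M' := matched_sym _ _ _ _ A M).
  pose proof M as (_ & qy & hM).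
  assert (iG : forall g : Ga, inSD (delta x g, idc))
    by (intros; now apply inSD_K, fin_supp_delta).
  assert (iH : forall h : Gt, inSD (delta y h, idc))
    by (intros; now apply inSD_K, fin_supp_delta).
  set (be := fun g : Ga => fst (t (delta x g, idc)) y).
  assert (tb : forall g, t (delta x g, idc) = (delta y (be g), idc))
    by (intros g; now apply (SDiso_delta al alt t t')).
  destruct (contracting_ex x qx) as (v & hv & ev & sv).
  assert (spv := matched_slope _ _ x y v A M hv ev sv).
  assert (epv : quot _ _ t v y = y) by now apply hM.
  assert (hi := isV_inv v hv).
  (* With [c] the value at [y] of the image of [Vinv v], whose slope exponent is [1], [SDiso_conj]
     reads [c alt(be g) = be(al g) c]; hence [h = c^-1]. *)
  exists be, (ginv (fst (t (onef, Vinv v)) y)). split.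
  - split; [|split].
    + intros g g'.
      assert (E := sd_mul _ _ _ _ I _ _ (iG g) (iG g')).
      rewrite sdmul_KK, <- delta_mul, !tb, sdmul_KK in E.
      injection E as E. rewrite <- delta_mul in E.
      now rewrite <- (delta_eq _ y (be (gmul g g'))), E, delta_eq.
    + intros g g' e.
      assert (E : (delta x g, idc) = (delta x g', idc)).
      { apply (SDiso_inj al alt t t'); auto. now rewrite !tb, e. }
      injection E as E. now rewrite <- (delta_eq _ x g), E, delta_eq.
    + intros h. exists (fst (t' (delta y h, idc)) x).
      assert (E := SDiso_delta alt al t' t y x h I' M').
      apply (f_equal t) in E. rewrite (sd_K' _ _ _ _ I) in E by auto.
      rewrite tb in E. injection E as E.
      now rewrite <- (delta_eq _ y (be _)), <- E, delta_eq.
  - intros g.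
    assert (ei : Vinv v x = x) by now apply Vinv_eq.
    assert (si : slope (Vinv v) x 1).
    { rewrite <- ev. now apply (slope_inv v x (-1)). }
    assert (E := SDiso_conj _ _ al alt t t' I (Vinv v) (delta x g) y hi
      (fin_supp_delta _ x g qx)).
    rewrite (vact_delta _ al (Vinv v) x g 1) in E by auto.
    rewrite (Vaut_inv _ _ A v hv), tb, tb in E. cbn [fst] in E.
    rewrite (vact_delta _ alt (Vinv (quot _ _ t v)) y (be g) 1) in E.
    + rewrite !delta_eq in E. change (autpow alt 1 (be g)) with (alt (be g)) in E.
      change (autpow al 1 g) with (al g) in E.
      now rewrite ginvK, <- gmulA, <- E, gmulKl.
    + apply isV_inv. now apply (va_V _ _ A).
    + apply Vinv_eq; auto. now apply (va_V _ _ A).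
    + rewrite <- epv. apply (slope_inv _ y (-1)); auto. now apply (va_V _ _ A).
Qed.

(** * Twisting by a slope cocycle *)

Definition zero_from (x : cantor) (N : nat) : Prop := forall n, N <= n -> x n = false.

Definition is_len (x : cantor) (N : nat) : Prop :=
  zero_from x N /\ forall N', zero_from x N' -> N <= N'.

(** Length of the shortest [m] with [x = m.000...]; junk outside Q_2. *)
Definition len (x : cantor) : nat := epsilon (inhabits 0) (is_len x).

Lemma len_spec x : in_Q2 x -> is_len x (len x).
Proof.
  intros [N h]. apply (epsilon_spec (inhabits 0) (is_len x)).
  revert h. induction N as [N IH] using lt_wf_ind. intros h.
  destruct (classic (exists N', N' < N /\ zero_from x N')) as [(N' & l & k)|k].
  - now apply (IH N').
  - exists N. split; auto. intros N' h'. apply Nat.nlt_ge. intros l. eauto.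
Qed.

(** The last nonzero letter lies in [z]; for [z = zeros] final zeros of [m] would not count. *)
Lemma len_wcat m z : in_Q2 z -> z <> zeros -> len (wcat m z) = length m + len z.
Proof.
  intros q nz. destruct (len_spec z q) as [a b].
  destruct (len_spec (wcat m z) (proj2 (in_Q2_wcat m z) q)) as [c d].
  apply Nat.le_antisymm.
  - apply d. intros n l. replace n with (length m + (n - length m)) by lia.
    rewrite wcat_ge. apply a. lia.
  - set (L := len (wcat m z)) in *.
    assert (e : zero_from z (L - length m)).
    { intros n l. rewrite <- (wcat_ge m z n). apply c. lia. }
    destruct (Nat.le_gt_cases (length m) L) as [l|l].
    + apply b in e. lia.
    + exfalso. apply nz. apply functional_extensionality. intros n. apply e. lia.
Qed.

(** The 2-adic valuation of the dyadic rational [x], when [x] is nonzero. *)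
Definition nu (x : cantor) : Z := (- Z.of_nat (len x))%Z.

(** The exceptions are the images [m'.000...], the only points whose tail is zero. *)
Lemma slope_coboundary v : isV v -> exists L, forall y, in_Q2 y -> ~ In (v y) L ->
  (log2_slope v y + nu y)%Z = nu (v y).
Proof.
  intros hv. pose proof hv as (ms & ms' & l & p & _ & h).
  exists (map (fun m => wcat m zeros) ms'). intros y q n.
  destruct (p y) as [k [[lk c] _]].
  apply in_cyl_ex in c. destruct c as [z ->].
  rewrite h in n by auto. apply in_Q2_wcat in q.
  assert (nz : z <> zeros).
  { intros ->. apply n. apply in_map_iff. exists (nth k ms' []). split; auto.
    apply nth_In. congruence. }
  rewrite (log2_slope_eq v _ (Z.of_nat (length (nth k ms [])) -
    Z.of_nat (length (nth k ms' []))) hv).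
  - rewrite h by auto. unfold nu. rewrite !len_wcat by auto. lia.
  - exists (nth k ms []), (nth k ms' []). repeat split.
    + apply in_cyl_wcat.
    + intros t. now apply h.
Qed.

Section Twist.
Variables (Ga Gt : Group) (al : Aut Ga) (alt : Aut Gt) (be : Ga -> Gt) (h : Gt).
Hypothesis be_iso : group_iso be.
Hypothesis be_alt : forall g : Ga,
  aut_fun alt (be g) = gmul (gmul h (be (aut_fun al g))) (ginv h).

Let step (g : Gt) : Gt := gmul (ginv h) (alt g).
Let step' (g : Gt) : Gt := aut_inv alt (gmul h g).

(** [cocyc n] is the element with [be al^n be^-1 = ad (cocyc n) alt^n]. *)
Definition cocyc (n : Z) : Gt := ziter step step' n gone.

Lemma cocyc_succ n : cocyc (Z.succ n) = gmul (ginv h) (alt (cocyc n)).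
Proof.
  apply (ziter_succ step step'). intros g. unfold step, step'.
  now rewrite aut_funK, gmulKl.
Qed.

Lemma step_inj g g' : gmul (ginv h) (alt g) = gmul (ginv h) (alt g') -> g = g'.
Proof.
  intros e. apply gmul_injl in e. now rewrite <- (aut_invK alt g), e, aut_invK.
Qed.

(** The 1-cocycle identity; composed with the slope it matches the chain rule. *)
Lemma cocyc_add n m : cocyc (n + m) = gmul (cocyc n) (autpow alt n (cocyc m)).
Proof.
  revert n. apply Z.bi_induction.
  - intros ? ? ->. reflexivity.
  - simpl. now rewrite gmul1l.
  - intros n. rewrite Z.add_succ_l, !cocyc_succ, autpow_succ, <- gmulA, <- aut_hom.
    split; intros E.
    + now rewrite E.
    + now apply step_inj.
Qed.

Lemma be_hom x y : be (gmul x y) = gmul (be x) (be y).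
Proof. apply be_iso. Qed.

Lemma be_one : be gone = gone.
Proof. apply gidem. now rewrite <- be_hom, gmul1l. Qed.

Lemma cocyc_twist n g :
  gmul (be (autpow al n g)) (cocyc n) = gmul (cocyc n) (autpow alt n (be g)).
Proof.
  revert n. apply Z.bi_induction.
  - intros ? ? ->. reflexivity.
  - simpl. now rewrite gmul1l, gmul1r.
  - intros n. rewrite !autpow_succ, cocyc_succ.
    assert (E : be (al (autpow al n g)) =
      gmul (gmul (ginv h) (alt (be (autpow al n g)))) h).
    { rewrite be_alt, !gmulA, gmulVl, gmul1l. now rewrite gmulKV. }
    rewrite E, <- !gmulA, gmulKVl, <- !aut_hom.
    split; intros K.
    + now rewrite K.
    + now apply step_inj.
Qed.

(** The plain twist [be (a x) cocyc(s)], with [s] the slope exponent, is multiplicative but not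
    finitely supported. Conjugating it by the function [cocyc (nu x)] repairs this: by [cocyc_add]
    the right factor becomes [cocyc (s + nu y)], where [x = v y]. *)
Definition twist_fst (a : cantor -> Ga) (v : cantor -> cantor) : cantor -> Gt :=
  fun x => if excluded_middle_informative (in_Q2 x)
    then gmul (gmul (ginv (cocyc (nu x))) (be (a x)))
           (cocyc (log2_slope v (Vinv v x) + nu (Vinv v x)))
    else gone.

Definition twist (g : raw Ga) : raw Gt := (twist_fst (fst g) (snd g), snd g).

Lemma twist_fst_img a v y : isV v -> in_Q2 y ->
  twist_fst a v (v y) = gmul (gmul (ginv (cocyc (nu (v y)))) (be (a (v y))))
                          (cocyc (log2_slope v y + nu y)).
Proof.
  intros hv q. unfold twist_fst. destruct (excluded_middle_informative _) as [k|k].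
  - now rewrite VinvK.
  - exfalso. apply k. now apply in_Q2_V.
Qed.

Lemma twist_fst_out a v x : ~ in_Q2 x -> twist_fst a v x = gone.
Proof.
  intros k. unfold twist_fst. destruct (excluded_middle_informative _); tauto.
Qed.

Lemma in_Q2_preimage v y : isV v -> in_Q2 (v y) -> in_Q2 y.
Proof. intros hv q. rewrite <- (VinvK v y hv). apply in_Q2_V; auto using isV_inv. Qed.

Lemma twist_inSD g : inSD g -> inSD (twist g).
Proof.
  destruct g as [a v]. intros [[l hl] hv]. simpl in hl, hv. split; auto. simpl.
  destruct (slope_coboundary v hv) as [L hL].
  exists (l ++ L). intros x n. rewrite in_app_iff.
  destruct (classic (in_Q2 x)) as [q|q].
  2: { rewrite twist_fst_out in n; tauto. }
  split; auto. apply NNPP. intros k. apply n.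
  destruct (isV_surj v x hv) as [y <-].
  assert (qy := in_Q2_preimage v y hv q).
  assert (e : a (v y) = gone) by (apply NNPP; intros e; apply hl in e; tauto).
  (* Off the exceptional points both [cocyc] factors have the same index and cancel. *)
  rewrite twist_fst_img by auto. rewrite hL by tauto.
  now rewrite e, be_one, gmul1r, gmulVl.
Qed.

Lemma twist_inj g1 g2 : inSD g1 -> inSD g2 -> twist g1 = twist g2 -> g1 = g2.
Proof.
  destruct g1 as [a v], g2 as [b w]. intros [[l hl] hv] [[l' hl'] _] E.
  unfold twist in E. simpl in *. injection E as E <-. f_equal.
  apply functional_extensionality. intros x.
  destruct (classic (in_Q2 x)) as [q|q].
  - destruct (isV_surj v x hv) as [y <-].
    assert (qy := in_Q2_preimage v y hv q).
    apply (f_equal (fun c => c (v y))) in E.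
    rewrite !twist_fst_img in E by auto.
    apply gmul_injr, gmul_injl in E. now apply be_iso.
  - transitivity (@gone Ga); [|symmetry]; apply NNPP; intros k;
      [apply hl in k|apply hl' in k]; tauto.
Qed.

Lemma twist_surj k : inSD k -> exists g, inSD g /\ twist g = k.
Proof.
  destruct k as [b v]. intros [[l hl] hv]. simpl in hl, hv.
  destruct be_iso as [_ [inj surj]].
  assert (S : exists be' : Gt -> Ga, forall y, be (be' y) = y).
  { exists (fun y => epsilon (inhabits gone) (fun x => be x = y)). intros y.
    apply (epsilon_spec (inhabits gone) (fun x => be x = y)). auto. }
  destruct S as [be' K].
  (* Solves the formula of [twist_fst] for [be (a x)]. *)
  set (a := fun x => if excluded_middle_informative (in_Q2 x)
    then be' (gmul (gmul (cocyc (nu x)) (b x))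
      (ginv (cocyc (log2_slope v (Vinv v x) + nu (Vinv v x))))) else gone).
  assert (aI : forall y, in_Q2 y -> be (a (v y)) =
    gmul (gmul (cocyc (nu (v y))) (b (v y))) (ginv (cocyc (log2_slope v y + nu y)))).
  { intros y q. unfold a. destruct (excluded_middle_informative _) as [i|i].
    - now rewrite K, VinvK.
    - exfalso. apply i. now apply in_Q2_V. }
  exists (a, v). split; [split; auto|].
  - destruct (slope_coboundary v hv) as [L hL].
    exists (l ++ L). intros x n. rewrite in_app_iff. cbn [fst] in n.
    destruct (classic (in_Q2 x)) as [q|q].
    2: { unfold a in n. destruct (excluded_middle_informative _); tauto. }
    split; auto. apply NNPP. intros k. apply n.
    destruct (isV_surj v x hv) as [y <-].
    assert (qy := in_Q2_preimage v y hv q).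
    assert (e : b (v y) = gone) by (apply NNPP; intros e; apply hl in e; tauto).
    apply inj. rewrite aI, be_one by auto. rewrite hL by tauto.
    now rewrite e, gmul1r, gmulVr.
  - unfold twist. simpl. f_equal. apply functional_extensionality. intros x.
    destruct (classic (in_Q2 x)) as [q|q].
    + destruct (isV_surj v x hv) as [y <-].
      assert (qy := in_Q2_preimage v y hv q).
      rewrite twist_fst_img, aI by auto.
      now rewrite !gmulA, gmulVl, gmul1l, gmulKV.
    + rewrite twist_fst_out by auto. symmetry. apply NNPP. intros k.
      apply hl in k. tauto.
Qed.

Lemma twist_mul g1 g2 : inSD g1 -> inSD g2 ->
  twist (sdmul al g1 g2) = sdmul alt (twist g1) (twist g2).
Proof.
  destruct g1 as [a v], g2 as [b w]. intros [_ hv] [_ hw]. simpl in hv, hw.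
  unfold twist, sdmul. simpl. f_equal.
  apply functional_extensionality. intros x.
  destruct (isV_surj v x hv) as [y <-]. destruct (isV_surj w y hw) as [z <-].
  rewrite vact_img by auto.
  destruct (classic (in_Q2 z)) as [q|q].
  - assert (qw : in_Q2 (w z)) by now apply in_Q2_V.
    rewrite (twist_fst_img _ (fun x => v (w x)) z) by auto using isV_comp.
    rewrite (twist_fst_img a v (w z)), (twist_fst_img b w z) by auto.
    rewrite vact_img, (log2_slope_comp v w z) by auto.
    set (n := log2_slope v (w z)). set (m := log2_slope w z).
    rewrite <- Z.add_assoc, !(cocyc_add n), !autpow_hom, autpow_inv, be_hom.
    rewrite <- !gmulA. do 2 f_equal.
    (* Moving [cocyc n] past the second factor turns [al^n] into [alt^n]. *)
    rewrite (gmulA _ (be _) (cocyc n)), cocyc_twist, <- !gmulA. f_equal.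
    now rewrite gmulKVl.
  - assert (qw : ~ in_Q2 (w z)) by (intros k; now apply in_Q2_preimage in k).
    assert (qv : ~ in_Q2 (v (w z))) by (intros k; now apply in_Q2_preimage in k).
    rewrite !twist_fst_out by auto. now rewrite autpow1, gmul1l.
Qed.

Lemma twisted_conjugate_isomorphic : sd_isomorphic al alt.
Proof.
  exists twist. repeat split.
  - now apply twist_inSD.
  - now apply twist_inSD.
  - exact twist_inj.
  - exact twist_surj.
  - exact twist_mul.
Qed.
End Twist.

Theorem theoremA (Ga Gt : Group) (al : Aut Ga) (alt : Aut Gt) :
  sd_isomorphic al alt <->
  exists (be : Ga -> Gt) (h : Gt),
    group_iso be /\
    forall g : Ga, aut_fun alt (be g) = gmul (gmul h (be (aut_fun al g))) (ginv h).
Proof.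
  split.
  - apply isomorphic_twisted_conjugate.
  - intros (be & h & be_iso & be_alt).
    exact (twisted_conjugate_isomorphic Ga Gt al alt be h be_iso be_alt).
Qed.
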